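(* Let $A$ be a homogeneous self-similar set with the strong separation condition (SSC), that is, $A$ is the disjoint union of $q$ similar $r$-scaled copies of $A$ for some real $r>0$ and integer $q>1$. Let $k$ be the maximal positive integer such that $\sqrt[k]{q}$ is an integer. Let $B$ be any self-similar set with the SSC such that $\dim_H A=\dim_H B$. Then the following statements are equivalent: (i) $A$ can be mapped onto $B$ by a Lipschitz map; (ii) all similarity ratios of $B$ are positive integer powers of $\sqrt[k]{r}$; (iii) $A$ and $B$ are bilipschitz equivalent.
   Context: $\dim_H$ denotes Hausdorff dimension. A self-similar set is a nonempty compact $K\subset\mathbb{R}^n$ with $K=\bigcup_{i=1}^m f_i(K)$ for finitely many contracting similarity maps $f_1,\dots,f_m$ of $\mathbb{R}^n$; it satisfies the SSC if $f_i(K)\cap f_j(K)=\emptyset$ for all $1\le i<j\le m$, and it is homogeneous if all the maps $f_i$ have the same similarity ratio. Self-similar sets are considered together with a fixed finite system of contracting similarity maps $f_1,\dots,f_m$ of $\mathbb{R}^n$ satisfying $K=\bigcup_{i=1}^m f_i(K)$: here $A$ is given by $q$ contracting similarities all of ratio $r$ satisfying the SSC, and $B$ (possibly in a different Euclidean space) by contracting similarities $g_1,\dots,g_m$ satisfying the SSC; the similarity ratios of $B$ are the ratios of $g_1,\dots,g_m$. A map $f$ between metric spaces is Lipschitz if there is a finite $C$ with $d(f(x),f(z))\le C\,d(x,z)$ for all $x,z$ in its domain. Two metric spaces are bilipschitz equivalent if there is a bijection between them such that both it and its inverse are Lipschitz. *)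

(* Defs.v *)
From HB Require Import structures.
From mathcomp Require Import all_boot all_order all_algebra.
From mathcomp Require Import all_classical all_reals all_analysis.
Set Implicit Arguments.
Unset Strict Implicit.
Unset Printing Implicit Defensive.
Import Order.TTheory GRing.Theory Num.Theory.
Import numFieldNormedType.Exports.
Local Open Scope classical_set_scope.
Local Open Scope ring_scope.

(* The library norm on ['rV[R]_n] is the sup norm, so the Euclidean distance is
   defined here and used for every metric notion below.  It induces the library
   topology of ['rV[R]_n], which is the one used for [compact]. *)
Definition edist (R : realType) (n : nat) (x y : 'rV[R]_n) : R :=
  Num.sqrt (\sum_(i < n) (x 0 i - y 0 i) ^+ 2).

(* The diameter of [set0] is [-oo]. *)
Definition ediam (R : realType) (n : nat) (U : set 'rV[R]_n) : \bar R :=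
  ereal_sup [set (edist p.1 p.2)%:E | p in U `*` U].

(* [|U|^s] with [|set0|^s = 0] for every [s]; for [s = 0] and [U] nonempty it
   is [1], so that the 0-dimensional Hausdorff measure is the counting measure. *)
Definition ediam_pow (R : realType) (n : nat) (s : R) (U : set 'rV[R]_n) :
    \bar R :=
  if `[< U = set0 >] then 0%E else poweR (ediam U) s.

(* Finite covers are included, by padding with [set0]. *)
Definition hausdorff_content (R : realType) (n : nat) (s delta : R)
    (K : set 'rV[R]_n) : \bar R :=
  ereal_inf [set (\sum_(0 <= i <oo) ediam_pow s (U i))%E |
    U in [set U : nat -> set 'rV[R]_n |
      K `<=` \bigcup_i U i /\ forall i, (ediam (U i) <= delta%:E)%E]].

Definition hausdorff_measure (R : realType) (n : nat) (s : R)
    (K : set 'rV[R]_n) : \bar R :=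
  ereal_sup [set hausdorff_content s delta K | delta in [set d : R | 0 < d]].

Definition hausdorff_dim (R : realType) (n : nat) (K : set 'rV[R]_n) : \bar R :=
  ereal_inf [set s%:E | s in [set s : R |
    0 <= s /\ hausdorff_measure s K = 0%E]].

Definition contracting_similarity (R : realType) (n : nat) (rho : R)
    (f : 'rV[R]_n -> 'rV[R]_n) : Prop :=
  0 < rho < 1 /\ forall x y, edist (f x) (f y) = rho * edist x y.

(* [K] is the self-similar set of the maps [f i], of ratios [rho i]. *)
Definition self_similar (R : realType) (n m : nat) (rho : 'I_m -> R)
    (f : 'I_m -> 'rV[R]_n -> 'rV[R]_n) (K : set 'rV[R]_n) : Prop :=
  [/\ forall i, contracting_similarity (rho i) (f i),
      K !=set0, compact K & K = \bigcup_i (f i @` K)].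

Definition SSC (R : realType) (n m : nat) (f : 'I_m -> 'rV[R]_n -> 'rV[R]_n)
    (K : set 'rV[R]_n) : Prop :=
  forall i j : 'I_m, (i < j)%N -> (f i @` K) `&` (f j @` K) = set0.

(* A map on [A] is represented by a function on the whole space, whose values
   outside [A] are irrelevant. *)
Definition elipschitz_on (R : realType) (n1 n2 : nat) (A : set 'rV[R]_n1)
    (f : 'rV[R]_n1 -> 'rV[R]_n2) : Prop :=
  exists C : R, forall x z, A x -> A z -> edist (f x) (f z) <= C * edist x z.

Definition lipschitz_onto (R : realType) (n1 n2 : nat)
    (A : set 'rV[R]_n1) (B : set 'rV[R]_n2) : Prop :=
  exists2 f : 'rV[R]_n1 -> 'rV[R]_n2, f @` A = B & elipschitz_on A f.

Definition bilipschitz_equivalent (R : realType) (n1 n2 : nat)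
    (A : set 'rV[R]_n1) (B : set 'rV[R]_n2) : Prop :=
  exists (f : 'rV[R]_n1 -> 'rV[R]_n2) (g : 'rV[R]_n2 -> 'rV[R]_n1),
    [/\ set_bij A B f, (forall x, A x -> g (f x) = x),
        elipschitz_on A f & elipschitz_on B g].

Definition kth_root (R : realType) (k : nat) (x : R) : R := x `^ (k%:R^-1).

Definition max_root_index (R : realType) (q k : nat) : Prop :=
  [/\ (0 < k)%N, kth_root k (q%:R : R) \is a Num.int &
      forall j : nat, (0 < j)%N -> kth_root j (q%:R : R) \is a Num.int ->
        (j <= k)%N].

(* Main.v *)
(* Write q = b^k with k maximal and let s = log q / log (1/r), so that the Moran
   equation of [B] is solved by s as well.

   If all ratios of [B] are powers theta^p_j of theta = r^(1/k), the Moran equation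
   reads sum_j b^-p_j = 1, and the equality case of Kraft's inequality provides a
   complete prefix code with word lengths p_j over b letters.  Reading the symbolic
   address of a point through this code identifies [B], up to bilipschitz maps, with
   the b-ary sequences metrised by theta^(length of the common prefix).  The same
   holds for [A], with q code words of length k.

   Conversely, let h map [A] onto [B] and be Lipschitz.  By the SSC, the preimage of
   a cylinder J of [B] is a union of cylinders of [A] of diameter comparable to that
   of J, so its uniform mass is N / q^l with q^-l comparable to the weight
   (product of the rho_j^s) of J.  The quotients weight / mass are bounded.  Since
   weight and mass are additive, a cylinder J whose quotient is almost maximal has
   subcylinders whose quotients are almost the same, and there N is bounded.  Only
   finitely many values being possible, the approximate identities are exact:
   x = rho_j^s satisfies x^l = N_l / (N_0 q^e_l) with N_l bounded independently of l.
   Hence x is rational and a power of x is a power of q; as b is not a perfect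
   power, x is a power of 1/b. *)
Require Import Defs.
From mathcomp Require Import all_boot all_order all_algebra.
From mathcomp Require Import all_classical all_reals all_analysis.
From mathcomp Require Import ring lra.
(* [edist] would otherwise be that of MathComp-Analysis. *)
Import Defs.
Import Order.TTheory GRing.Theory Num.Theory.
Import numFieldNormedType.Exports.
Set Implicit Arguments.
Unset Strict Implicit.
Unset Printing Implicit Defensive.
Local Open Scope classical_set_scope.
Local Open Scope ring_scope.

(** * The Euclidean distance *)

Section EuclideanDistance.
Variables (R : realType) (n : nat).
Implicit Types (x y z : 'rV[R]_n) (K : set 'rV[R]_n).

Lemma edist_ge0 x y : 0 <= edist x y.
Proof. exact: sqrtr_ge0. Qed.

Lemma edistxx x : edist x x = 0.
Proof. by rewrite /edist big1 ?sqrtr0// => i _; rewrite subrr expr0n. Qed.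

Lemma edistC x y : edist x y = edist y x.
Proof. by rewrite /edist; congr Num.sqrt; apply: eq_bigr => i _; ring. Qed.

Lemma edist_eq0 x y : edist x y = 0 -> x = y.
Proof.
move/eqP; rewrite sqrtr_eq0 => le0; apply/rowP => i.
have : \sum_(i < n) (x 0 i - y 0 i) ^+ 2 == 0.
  by rewrite eq_le le0/= sumr_ge0// => j _; exact: sqr_ge0.
rewrite psumr_eq0; last by move=> j _; exact: sqr_ge0.
move=> /allP/(_ i); rewrite mem_index_enum => /(_ isT).
by rewrite sqrf_eq0 subr_eq0 => /eqP.
Qed.

Lemma edist_gt0 x y : x <> y -> 0 < edist x y.
Proof.
by move=> xy; rewrite lt_neqAle edist_ge0 andbT eq_sym; apply/eqP => /edist_eq0.
Qed.

(** The constant 2 avoids Minkowski's inequality: only [(a + b)^2 <= 2 * (a^2 + b^2)] is used in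
    each coordinate, and this is enough for the compactness arguments below. *)
Lemma edist_quasi_triangle z x y : edist x y <= 2 * (edist x z + edist z y).
Proof.
rewrite -ler_sqr ?nnegrE ?edist_ge0//; last first.
  by rewrite mulr_ge0// addr_ge0// edist_ge0.
have edist2 u v : edist u v ^+ 2 = \sum_(i < n) (u 0 i - v 0 i) ^+ 2.
  by rewrite sqr_sqrtr// sumr_ge0// => j _; exact: sqr_ge0.
apply: (@le_trans _ _ (2 * (edist x z ^+ 2 + edist z y ^+ 2))).
  rewrite !edist2 -big_split mulr_sumr/=; apply: ler_sum => i _.
  by have := sqr_ge0 ((x 0 i - z 0 i) - (z 0 i - y 0 i)); nra.
by have := edist_ge0 x z; have := edist_ge0 z y; nra.
Qed.

(** Links [edist] to the sup-norm topology in which [compact] is stated: coordinates closer than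
    [e / (n + 1)] give a squared distance at most [n * e^2 / (n + 1)^2 < e^2]. *)
Lemma edist_small x (e : R) : 0 < e -> \forall y \near x, edist x y < e.
Proof.
move=> e0; have e'0 : 0 < e / n.+1%:R by rewrite divr_gt0.
near=> y.
have xy i : `|x 0 i - y 0 i| < e / n.+1%:R.
  have : ball x (e / n.+1%:R) y by near: y; exact: nbhsx_ballx.
  by move=> [_ /(_ 0 i)].
rewrite -ltr_sqr ?nnegrE ?edist_ge0 ?ltW// sqr_sqrtr; last first.
  by rewrite sumr_ge0// => j _; exact: sqr_ge0.
apply: (@le_lt_trans _ _ (\sum_(i < n) (e / n.+1%:R) ^+ 2)).
  apply: ler_sum => i _; rewrite -real_normK ?num_real//.
  by rewrite ler_sqr ?nnegrE// ltW.
rewrite sumr_const card_ord -[_ *+ n]mulr_natr expr_div_n -mulrA gtr_pMr ?exprn_gt0//.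
rewrite mulrC ltr_pdivrMr ?exprn_gt0// mul1r -natrX ltr_nat.
by rewrite expnS expn1 leq_pmulr.
Unshelve. all: by end_near. Qed.

Lemma compact_subsequence K (u : nat -> 'rV[R]_n) :
  compact K -> (forall i, K (u i)) ->
  exists y, K y /\ exists phi : nat -> nat,
    forall i, (i <= phi i)%N /\ edist y (u (phi i)) < i.+1%:R^-1.
Proof.
move=> cK uK; have [] := cK (u @ \oo) _; first by exists 0%N => // i _; exact: uK.
move=> y [Ky cy]; exists y; split=> //.
suff /choice[phi phiP] : forall i, exists j,
  (i <= j)%N /\ edist y (u j) < i.+1%:R^-1 by exists phi.
move=> i; have /= := cy (u @` [set j | (i <= j)%N])
  [set z | edist y z < i.+1%:R^-1].
case=> //.
- by exists i => // j /= ij; exists j.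
- by apply: edist_small; rewrite invr_gt0.
by move=> z [[j/= ij <-]] yz; exists j.
Qed.

End EuclideanDistance.

(** * Limits and finite families of conditions on reals *)

Section RealTools.
Variable R : realType.
Implicit Types (x a e : R) (T : finType).

Lemma expr_lt_eventually x e : 0 <= x < 1 -> 0 < e ->
  exists N, forall n, (N <= n)%N -> x ^+ n < e.
Proof.
move=> /andP[x0 x1] e0; have xn1 : `|x| < 1 by rewrite ger0_norm.
have /cvgrPdist_lt/(_ _ e0)[N _ NP] := cvg_expr xn1.
exists N => n /NP; rewrite sub0r normrN ger0_norm ?exprn_ge0//.
Qed.

Lemma invS_lt_eventually e : 0 < e ->
  exists N, forall n, (N <= n)%N -> (n.+1%:R^-1 : R) < e.
Proof.
by move=> e0; have [N _ NP] := near_infty_natSinv_lt (PosNum e0); exists N.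
Qed.

Lemma finite_pos_lower_bound T (P : T -> R -> Prop) :
  (forall t d e, 0 < d <= e -> P t e -> P t d) ->
  (forall t, exists2 e, 0 < e & P t e) ->
  exists2 e, 0 < e & forall t, P t e.
Proof.
move=> Pmono Pex.
have /choice[f fP] : forall t, exists e, 0 < e /\ P t e.
  by move=> t; have [e] := Pex t; exists e.
have f0 : 0 < \big[Num.min/1]_t f t.
  by apply: lt_bigmin => // t _; case: (fP t).
exists (\big[Num.min/1]_t f t) => // t.
by apply: (Pmono _ _ (f t)); [rewrite f0 bigmin_le | case: (fP t)].
Qed.

(** Pigeonhole as [e] tends to 0: if each [t] failed at some positive [e], all would fail at a
    common one. This turns approximate relations with finitely many candidates into exact ones. *)
Lemma finite_limit_exists T (P : T -> R -> Prop) :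
  (forall t d e, 0 < d <= e -> P t d -> P t e) ->
  (forall e, 0 < e -> exists t, P t e) ->
  exists t, forall e, 0 < e -> P t e.
Proof.
move=> Pmono Pex; apply/not_existsP => nP.
have [|t|e e0 eP] := @finite_pos_lower_bound T (fun t e => ~ P t e).
- by move=> t d e de nPe Pd; apply: nPe; exact: Pmono Pd.
- by have /existsNP[e /not_implyP[e0 nPe]] := nP t; exists e.
- by have [t] := Pex _ e0; exact: eP.
Qed.

End RealTools.

(** * Self-similar sets and their cylinders *)

Definition gap_at_least (R : realType) (n m : nat) (g : 'I_m -> 'rV[R]_n -> 'rV[R]_n)
    (K : set 'rV[R]_n) (delta : R) :=
  forall i j x y, i != j -> K x -> K y -> delta <= edist (g i x) (g j y).

Fixpoint cylinder (R : realType) (n m : nat) (g : 'I_m -> 'rV[R]_n -> 'rV[R]_n)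
    (K : set 'rV[R]_n) (w : seq 'I_m) : set 'rV[R]_n :=
  if w is j :: w' then g j @` cylinder g K w' else K.

Section SelfSimilarSets.
Variables (R : realType) (n m : nat) (rho : 'I_m -> R).
Variables (g : 'I_m -> 'rV[R]_n -> 'rV[R]_n) (K : set 'rV[R]_n).
Hypothesis K_ss : self_similar rho g K.

Lemma ratio_gt0 i : 0 < rho i.
Proof. by case: K_ss => /(_ i)[/andP[]]. Qed.

Lemma ratio_lt1 i : rho i < 1.
Proof. by case: K_ss => /(_ i)[/andP[]]. Qed.

Lemma edist_map i x y : edist (g i x) (g i y) = rho i * edist x y.
Proof. by case: K_ss => /(_ i)[]. Qed.

Lemma map_inj i : injective (g i).
Proof.
move=> x y gxy; apply: edist_eq0; apply/eqP.
have := edist_map i x y; rewrite gxy edistxx => /esym/eqP.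
by rewrite mulf_eq0 gt_eqF ?ratio_gt0.
Qed.

Lemma self_similar_image i x : K x -> K (g i x).
Proof. by case: K_ss => _ _ _ {2}-> Kx; exists i => //; exists x. Qed.

Lemma self_similar_preimage x : K x -> exists i y, K y /\ x = g i y.
Proof. by case: K_ss => _ _ _ {1}-> [i _ [y Ky <-]]; exists i, y. Qed.

Lemma self_similar_bounded :
  exists2 D, 0 < D & forall x y, K x -> K y -> edist x y <= D.
Proof.
have [_ [x0 Kx0] cK _] := K_ss.
suff [D D0] : exists2 D, 0 <= D & forall x, K x -> edist x0 x <= D.
  move=> DP; exists (2 * (D + D) + 1) => [|x y Kx Ky]; first by lra.
  rewrite (le_trans (edist_quasi_triangle x0 _ _))//.
  by rewrite (edistC x); have := DP _ Kx; have := DP _ Ky; lra.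
apply: contrapT => nD.
have /choice[u uP] : forall i : nat, exists x, K x /\ i%:R < edist x0 x.
  move=> i; apply: contrapT => /forallNP ni; apply: nD; exists i%:R => // x Kx.
  by rewrite leNgt; apply/negP => ix; apply: (ni x).
have [|y [Ky [phi phiP]]] := @compact_subsequence _ _ _ u cK.
  by move=> i; case: (uP i).
(* A term within 1 of [y] is at distance less than [2 * (edist x0 y + 1)] from [x0], yet the term of
   index [phi N >= N] is further away than [N]. *)
pose N := Num.bound (2 * (edist x0 y + 1)).
have [Nphi yu] := phiP N; have [_] := uP (phi N).
have N_gt : 2 * (edist x0 y + 1) < N%:R.
  by apply: archi_boundP; rewrite mulr_ge0// addr_ge0// edist_ge0.
have : N%:R <= (phi N)%:R :> R by rewrite ler_nat.
have : edist y (u (phi N)) < 1 by rewrite (lt_le_trans yu)// invf_le1// ler1n.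
by have := edist_quasi_triangle y x0 (u (phi N)); lra.
Qed.

(** If two pieces came arbitrarily close, compactness would give [x] and [y] in [K] with
    [g i x = g j y], a common point of the two pieces. *)
Lemma SSC_separated : SSC g K -> exists2 delta, 0 < delta & gap_at_least g K delta.
Proof.
move=> Kssc; have cK : compact K by case: K_ss.
pose P (ij : 'I_m * 'I_m) (d : R) := ij.1 != ij.2 ->
  forall x y, K x -> K y -> d <= edist (g ij.1 x) (g ij.2 y).
have [t d e /andP[_ de] Pe ij x y Kx Ky||d d0 dP] := @finite_pos_lower_bound R _ P.
- exact: le_trans de (Pe ij x y Kx Ky).
- move=> [i j]; have [->|ij] := eqVneq i j; first by exists 1; rewrite ?/P ?eqxx.
  apply: contrapT => ne.
  have H a : exists xy, [/\ K xy.1, K xy.2 &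
      edist (g i xy.1) (g j xy.2) < a.+1%:R^-1].
    apply: contrapT => /forallNP na; apply: ne; exists a.+1%:R^-1 => // _ x y Kx Ky.
    by rewrite leNgt; apply/negP => xy; apply: (na (x, y)).
  have [u uP] := choice H.
  have [|x [Kx [phi phiP]]] := @compact_subsequence _ _ _ (fst \o u) cK.
    by move=> a; case: (uP a).
  have [|y [Ky [psi psiP]]] := @compact_subsequence _ _ _ (snd \o u \o phi) cK.
    by move=> a; case: (uP (phi a)).
  have gxy : g i x = g j y.
    apply: edist_eq0; apply/eqP; rewrite eq_le edist_ge0 andbT leNgt.
    (* With [d] the distance of [g i x] and [g j y], two quasi-triangle steps through three
       distances below [d / 16] give [d <= 2 * (1 + 2 * 2) * d / 16 < d]. *)
    apply/negP => xy0; have xy16 : 0 < edist (g i x) (g j y) / 16 by lra.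
    have [N /(_ N (leqnn N)) eN] := invS_lt_eventually xy16.
    have [Npsi yN] := psiP N; have [psiphi xN] := phiP (psi N).
    have [_ _ pN] := uP (phi (psi N)); set p := u _ in yN xN pN *.
    have x_close : edist x p.1 < edist (g i x) (g j y) / 16.
      rewrite (lt_trans (lt_le_trans xN _) eN)// lef_pV2 ?posrE// ler_nat ltnS.
      exact: Npsi.
    have y_close : edist y p.2 < edist (g i x) (g j y) / 16 by exact: lt_trans eN.
    have p_close : edist (g i p.1) (g j p.2) < edist (g i x) (g j y) / 16.
      rewrite (lt_trans (lt_le_trans pN _) eN)// lef_pV2 ?posrE// ler_nat ltnS.
      exact: leq_trans psiphi.
    have x_close' : edist (g i x) (g i p.1) <= edist x p.1.
      by rewrite edist_map ler_piMl ?edist_ge0 ?ltW ?ratio_lt1.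
    have y_close' : edist (g j p.2) (g j y) <= edist y p.2.
      by rewrite edistC edist_map ler_piMl ?edist_ge0 ?ltW ?ratio_lt1.
    have := edist_quasi_triangle (g i p.1) (g i x) (g j y).
    have := edist_quasi_triangle (g j p.2) (g i p.1) (g j y).
    lra.
  have [ij'|ij'|/val_inj ij'] := ltngtP i j; last by rewrite ij' eqxx in ij.
  - have := Kssc i j ij'; apply/eqP/set0P; exists (g i x).
    by split; [exists x | rewrite gxy; exists y].
  - have := Kssc j i ij'; apply/eqP/set0P; exists (g i x).
    by split; [rewrite gxy; exists y | exists x].
- by exists d => // i j x y ij Kx Ky; exact: (dP (i, j)).
Qed.

End SelfSimilarSets.

(** * Weights of words and geometry of cylinders *)

Definition word_weight (R : realType) (m : nat) (p : 'I_m -> R) (w : seq 'I_m) : R :=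
  \prod_(j <- w) p j.

Section WordWeight.
Variables (R : realType) (m : nat) (p : 'I_m -> R).

Lemma word_weight_nil : word_weight p [::] = 1.
Proof. by rewrite /word_weight big_nil. Qed.

Lemma word_weight_cons j w : word_weight p (j :: w) = p j * word_weight p w.
Proof. by rewrite /word_weight big_cons. Qed.

Lemma word_weight_rcons w j : word_weight p (rcons w j) = word_weight p w * p j.
Proof. by rewrite /word_weight -cats1 big_cat big_seq1. Qed.

Lemma word_weight_cat v w :
  word_weight p (v ++ w) = word_weight p v * word_weight p w.
Proof. by rewrite /word_weight big_cat. Qed.

Lemma word_weight_gt0 w : (forall j, 0 < p j) -> 0 < word_weight p w.
Proof. by move=> p0; apply: prodr_gt0. Qed.

Lemma word_weight_le1 w : (forall j, 0 < p j <= 1) -> word_weight p w <= 1.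
Proof.
move=> p01; elim: w => [|j w IH]; first by rewrite word_weight_nil.
have /andP[p0 p1] := p01 j; rewrite word_weight_cons mulr_ile1//; first exact: ltW.
by rewrite ltW// word_weight_gt0// => i; case/andP: (p01 i).
Qed.

Lemma word_weight_nseq l j : word_weight p (nseq l j) = p j ^+ l.
Proof.
by elim: l => [|l IH]; rewrite ?word_weight_nil//= word_weight_cons IH exprS.
Qed.

End WordWeight.

Section Cylinders.
Variables (R : realType) (n m : nat) (rho : 'I_m -> R).
Variables (g : 'I_m -> 'rV[R]_n -> 'rV[R]_n) (K : set 'rV[R]_n).
Hypothesis K_ss : self_similar rho g K.
Notation cyl := (cylinder g K).
Notation rho_ := (word_weight rho).

Lemma word_ratio_gt0 w : 0 < rho_ w.
Proof. by apply: word_weight_gt0 => j; exact: ratio_gt0 K_ss j. Qed.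

Lemma cylinder_sub w : cyl w `<=` K.
Proof.
by elim: w => [|j w IH]//= _ [x /IH Kx <-]; exact: (self_similar_image K_ss).
Qed.

Lemma cylinder_neq0 w : cyl w !=set0.
Proof.
elim: w => [|j w [x wx]] /=; first by case: K_ss.
by exists (g j x); exists x.
Qed.

Lemma cylinder_rcons_sub w j : cyl (rcons w j) `<=` cyl w.
Proof.
elim: w => [|i w IH] x /=; first exact: (@cylinder_sub [:: j]).
by move=> [y /IH wy <-]; exists y.
Qed.

Lemma cylinder_rcons_ex w x : cyl w x -> exists j, cyl (rcons w j) x.
Proof.
elim: w x => [|i w IH] x /=.
  by move=> /(self_similar_preimage K_ss)[j [y [Ky ->]]]; exists j, y.
by move=> [y /IH[j wy] <-]; exists j, y.
Qed.

Lemma cylinder_word_ex l x : K x -> exists2 w, size w = l & cyl w x.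
Proof.
move=> Kx; elim: l => [|l [w <- /cylinder_rcons_ex[j wx]]]; first by exists [::].
by exists (rcons w j) => //; rewrite size_rcons.
Qed.

Lemma cylinder_diam D : (forall x y, K x -> K y -> edist x y <= D) ->
  forall w x y, cyl w x -> cyl w y -> edist x y <= rho_ w * D.
Proof.
move=> KD; elim=> [|j w IH] x y /=; first by rewrite word_weight_nil mul1r; exact: KD.
move=> [x' wx <-] [y' wy <-]; rewrite (edist_map K_ss) word_weight_cons -mulrA.
by rewrite ler_pM2l ?(ratio_gt0 K_ss)// IH.
Qed.

Section Separated.
Variable delta : R.
Hypotheses (delta_gt0 : 0 < delta) (K_sep : gap_at_least g K delta).

Lemma separated_digit i j x y : K x -> K y -> edist (g i x) (g j y) < delta -> i = j.
Proof.
by move=> Kx Ky; apply: contraPeq => ij; apply/negP; rewrite -leNgt; exact: K_sep.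
Qed.

(** Induction on [w]: the first letters agree because [delta * rho_ w <= delta], and cancelling that
    map divides both sides by its ratio. Cylinders are thus relatively open in [K]. *)
Lemma cylinder_gap w x y :
  cyl w x -> K y -> edist x y < delta * rho_ w -> cyl w y.
Proof.
elim: w x y => [|j w IH] x y //= [x' wx <-].
move=> /(self_similar_preimage K_ss)[i [y' [Ky' ->]]] xy.
have Kx' := cylinder_sub wx.
have ji : j = i.
  apply: (separated_digit Kx' Ky'); apply: lt_le_trans xy _.
  rewrite ler_piMr//; first exact: ltW.
  apply: word_weight_le1 => l.
  by rewrite (ratio_gt0 K_ss) ltW// (ratio_lt1 K_ss).
exists y' => //; last by rewrite ji.
apply: (IH x') => //; move: xy.
by rewrite -ji (edist_map K_ss) word_weight_cons mulrCA ltr_pM2l// (ratio_gt0 K_ss).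
Qed.

(** For [y] already in the parent cylinder, the gap at the parent's scale suffices; this drives the
    descent in [small_set_in_cylinder]. *)
Lemma cylinder_gap_rcons w j x y :
  cyl (rcons w j) x -> cyl w y -> edist x y < delta * rho_ w -> cyl (rcons w j) y.
Proof.
elim: w x y => [|i w IH] x y /=.
  rewrite word_weight_nil mulr1 => -[x' Kx' <-].
  move=> /(self_similar_preimage K_ss)[l [y' [Ky' ->]]] /(separated_digit Kx' Ky') <-.
  by exists y'.
move=> [x' wx <-] [y' wy <-].
rewrite (edist_map K_ss) word_weight_cons mulrCA ltr_pM2l ?(ratio_gt0 K_ss)// => xy.
by exists y' => //; exact: IH xy.
Qed.

Lemma cylinder_rcons_inj w i j x : cyl (rcons w i) x -> cyl (rcons w j) x -> i = j.
Proof.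
elim: w x => [|l w IH] x /= [y wy <-] [z wz].
  by move=> gzy; apply: (separated_digit wy wz); rewrite gzy edistxx.
by move=> /(map_inj K_ss) zy; apply: (IH y); rewrite // -zy.
Qed.

(** A cluster point of points chosen in the cylinders lies in each of them, since a chosen point of
    a deeper cylinder comes within the gap. *)
Lemma cylinder_nested (w : nat -> seq 'I_m) :
  (forall l, cyl (w l.+1) `<=` cyl (w l)) -> exists x, forall l, cyl (w l) x.
Proof.
move=> w_nested; have w_sub l l' : (l <= l')%N -> cyl (w l') `<=` cyl (w l).
  move=> /subnKC <-; elim: (l' - l)%N => [|d IH]; first by rewrite addn0.
  by rewrite addnS => x /w_nested; exact: IH.
have /choice[u uP] : forall l, exists x, cyl (w l) x.
  by move=> l; have [x] := cylinder_neq0 (w l); exists x.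
have cK : compact K by case: K_ss.
have [|x [Kx [phi phiP]]] := @compact_subsequence _ _ _ u cK.
  by move=> l; exact: cylinder_sub (uP l).
exists x => l; have e0 : 0 < delta * rho_ (w l) by rewrite mulr_gt0 ?word_ratio_gt0.
have [N NP] := invS_lt_eventually e0.
have [phiN xN] := phiP (maxn N l).
apply: (@cylinder_gap _ (u (phi (maxn N l)))) => //.
  by apply: (w_sub _ (phi (maxn N l))); rewrite ?(leq_trans _ phiN)// leq_maxr.
by rewrite edistC (lt_trans xN)// NP// leq_maxl.
Qed.

Lemma cylinder_finite_cover (I : set nat) (w : nat -> seq 'I_m) :
  K `<=` \bigcup_(i in I) cyl (w i) ->
  exists N, forall x, K x -> exists i, [/\ (i < N)%N, I i & cyl (w i) x].
Proof.
move=> Kw; apply: contrapT => /forallNP nN.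
have /choice[u uP] : forall N, exists x,
    K x /\ forall i, (i < N)%N -> I i -> ~ cyl (w i) x.
  move=> N; apply: contrapT => /forallNP nx; apply: (nN N) => x Kx.
  by apply: contrapT => ni; apply: (nx x); split=> // i iN Ii wx; apply: ni; exists i.
have cK : compact K by case: K_ss.
have [|x [Kx [phi phiP]]] := @compact_subsequence _ _ _ u cK.
  by move=> l; case: (uP l).
have [i Ii wx] := Kw _ Kx.
have e0 : 0 < delta * rho_ (w i) by rewrite mulr_gt0 ?word_ratio_gt0.
have [N NP] := invS_lt_eventually e0.
have [phiN xN] := phiP (maxn N i.+1).
have [Ku] := uP (phi (maxn N i.+1)).
move=> /(_ i); apply=> //; first by rewrite (leq_trans _ phiN)// leq_maxr.
by apply: cylinder_gap wx Ku _; rewrite (lt_trans xN)// NP// leq_maxl.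
Qed.

(** Stands in for a self-similar measure: this is the finite subadditivity of the measure that gives
    the cylinder of [w] its weight. The induction is on a bound for the word lengths. *)
Lemma cylinder_cover_weight (p : 'I_m -> R) (ws : seq (seq 'I_m)) :
  (forall j, 0 < p j) -> \sum_j p j = 1 ->
  (forall x, K x -> exists2 w, w \in ws & cyl w x) ->
  1 <= \sum_(w <- ws) word_weight p w.
Proof.
move=> p0 p1; have [N] : exists N, all (fun w => size w < N)%N ws.
  exists (\sum_(w <- ws) size w).+1; apply/allP => w ww.
  by rewrite ltnS (big_rem w)//= leq_addr.
elim: N ws => [|N IH] ws wsN ws_cover.
  case: ws wsN ws_cover => // _ ws_cover.
  by case: K_ss => _ [x Kx] _ _; have [] := ws_cover x Kx.
have [ws0|ws0] := boolP ([::] \in ws).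
  rewrite (big_rem _ ws0)/= word_weight_nil lerDl sumr_ge0// => w _.
  by rewrite ltW// word_weight_gt0.
(* The tails of the words beginning with [j] cover [K] again, because no other word has a cylinder
   meeting the piece of [j]. *)
pose tl j := [seq behead w | w <- ws & ohead w == Some j].
have -> : \sum_(w <- ws) word_weight p w =
    \sum_j p j * \sum_(w <- tl j) word_weight p w.
  under [RHS]eq_bigr do rewrite big_map big_filter mulr_sumr.
  rewrite (exchange_big_dep predT)//=; apply: eq_big_seq => -[|j w] jw.
    by rewrite jw in ws0.
  by rewrite (big_pred1 j) ?word_weight_cons// => i /=; rewrite eq_sym.
rewrite -{1}p1 leNgt; apply/negP => sum_lt.
have [j] : exists j, \sum_(w <- tl j) word_weight p w < 1.
  apply: contrapT => /forallNP tl1; move: sum_lt; apply/negP; rewrite -leNgt.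
  by apply: ler_sum => j _; rewrite ler_peMr ?(ltW (p0 j))// leNgt; apply/negP/tl1.
apply/negP; rewrite -leNgt; apply: IH => [|x Kx].
  apply/allP => _ /mapP[w + ->]; rewrite mem_filter => /andP[wj ww].
  by move/allP: wsN => /(_ _ ww); case: w wj {ww}.
have [w ww] := ws_cover _ (self_similar_image K_ss j Kx).
case: w ww => [|i w] iw /=; first by rewrite iw in ws0.
move=> [y wy gyx]; have ij : i = j.
  by apply: (separated_digit (cylinder_sub wy) Kx); rewrite gyx edistxx.
exists w; last by move: gyx; rewrite ij => /(map_inj K_ss) <-.
by apply/mapP; exists (i :: w) => //; rewrite mem_filter iw ij/= eqxx.
Qed.

End Separated.
End Cylinders.

(** * Hausdorff and similarity dimension *)

Section Dimension.
Variables (R : realType) (n m : nat) (rho : 'I_m -> R).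
Variables (g : 'I_m -> 'rV[R]_n -> 'rV[R]_n) (K : set 'rV[R]_n).
Hypothesis K_ss : self_similar rho g K.
Notation cyl := (cylinder g K).
Notation rho_ := (word_weight rho).

Lemma ratio_uniform_lt1 : exists2 c, 0 <= c < 1 & forall j, rho j <= c.
Proof.
have [j d e /andP[_ de]|j|e e0 eP] := @finite_pos_lower_bound R _ (fun j e => rho j <= 1 - e).
- by move=> /le_trans; apply; rewrite lerB.
- by exists (1 - rho j); rewrite ?subr_gt0 ?(ratio_lt1 K_ss)//; lra.
exists (Num.max 0 (1 - e)); first by rewrite le_max lexx/= gt_max ltr01/=; lra.
by move=> j; rewrite le_max eP orbT.
Qed.

Lemma word_ratio_le c w : (forall j, rho j <= c) -> rho_ w <= c ^+ size w.
Proof.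
move=> rc; elim: w => [|j w IH]; first by rewrite word_weight_nil.
rewrite word_weight_cons exprS; apply: ler_pM => //; apply: ltW.
  exact: (ratio_gt0 K_ss).
exact: (word_ratio_gt0 K_ss).
Qed.

Lemma word_ratio_small e : 0 < e -> exists l, forall w, size w = l -> rho_ w < e.
Proof.
move=> e0; have [c c01 rc] := ratio_uniform_lt1.
have [l lP] := expr_lt_eventually c01 e0; exists l => w wl.
by rewrite (le_lt_trans (word_ratio_le w rc))// lP// wl.
Qed.

Lemma word_ratio_powR s w : rho_ w `^ s = word_weight (fun j => rho j `^ s) w.
Proof.
elim: w => [|j w IH]; first by rewrite !word_weight_nil powR1.
by rewrite !word_weight_cons powRM ?ltW ?(word_ratio_gt0 K_ss) ?(ratio_gt0 K_ss)// IH.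
Qed.

Fixpoint words l : seq (seq 'I_m) :=
  if l is l'.+1 then [seq j :: w | j <- index_enum 'I_m, w <- words l'] else [:: [::]].

Lemma mem_words l w : (w \in words l) = (size w == l).
Proof.
elim: l w => [|l IH] [|j w] //=.
  by apply/negbTE/allpairsP => -[[j w] []].
apply/allpairsP/eqP => [[[i v] /= [_ + [_ ->]]]|[wl]].
  by rewrite IH => /eqP ->.
by exists (j, w); rewrite mem_index_enum IH wl.
Qed.

Lemma sum_words (p : 'I_m -> R) l :
  \sum_(w <- words l) word_weight p w = (\sum_j p j) ^+ l.
Proof.
elim: l => [|l IH]; first by rewrite big_seq1 word_weight_nil.
rewrite /= big_allpairs_dep exprS -IH big_distrl/=; apply: eq_bigr => j _.
by rewrite mulr_sumr; apply: eq_bigr => w _; rewrite word_weight_cons.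
Qed.

Lemma ediam_le (U : set 'rV[R]_n) d : (forall x y, U x -> U y -> edist x y <= d) ->
  (ediam U <= d%:E)%E.
Proof.
by move=> Ud; apply: ge_ereal_sup => _ [[x y] [/= Ux Uy] <-]; rewrite lee_fin Ud.
Qed.

Lemma edist_le_ediam (U : set 'rV[R]_n) x y : U x -> U y ->
  ((edist x y)%:E <= ediam U)%E.
Proof. by move=> Ux Uy; apply: ereal_sup_ubound; exists (x, y). Qed.

Lemma ediam_ge0 (U : set 'rV[R]_n) : U !=set0 -> (0 <= ediam U)%E.
Proof. by move=> [x Ux]; have := edist_le_ediam Ux Ux; rewrite edistxx. Qed.

Lemma ediam_pow_ge0 s (U : set 'rV[R]_n) : (0 <= ediam_pow s U)%E.
Proof. by rewrite /ediam_pow; case: ifP => // _; exact: poweR_ge0. Qed.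

Lemma ediam_pow_le s d (U : set 'rV[R]_n) : 0 <= s -> 0 <= d ->
  (ediam U <= d%:E)%E -> (ediam_pow s U <= (d `^ s)%:E)%E.
Proof.
move=> s0 d0 Ud; rewrite /ediam_pow; case: asboolP => [_|/eqP/set0P U0].
  by rewrite lee_fin powR_ge0.
rewrite -poweR_EFin; apply: gt0_ler_poweR => //; rewrite in_itv/= leey andbT.
  exact: ediam_ge0.
by rewrite lee_fin.
Qed.

(** Cover by the cylinders of one length [l]: their diameters tend to 0 uniformly, and the sum of
    the [s]-th powers is at most [D^s] times the [l]-th power of the Moran sum. *)
Lemma hausdorff_measure_eq0 s : 0 <= s -> \sum_j rho j `^ s < 1 ->
  hausdorff_measure s K = 0%E.
Proof.
move=> s0 S1; have [D D0 KD] := self_similar_bounded K_ss.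
have S0 : 0 <= \sum_j rho j `^ s by rewrite sumr_ge0// => j _; exact: powR_ge0.
suff content_le d e : 0 < d -> 0 < e -> (hausdorff_content s d K <= e%:E)%E.
  apply/eqP; rewrite eq_le; apply/andP; split.
    apply: ge_ereal_sup => _ [d/= d0 <-]; apply/lee_addgt0Pr => e e0.
    by rewrite add0e content_le.
  apply: (@le_trans _ _ (hausdorff_content s 1 K)); last first.
    by apply: ereal_sup_ubound; exists 1 => //=.
  apply: le_ereal_inf_tmp => _ [U _ <-].
  by apply: nneseries_ge0 => i _ _; exact: ediam_pow_ge0.
move=> d0 e0; have Ds0 : 0 < D `^ s by rewrite powR_gt0.
have dD0 : 0 < d / D by rewrite divr_gt0.
have eD0 : 0 < e / D `^ s by rewrite divr_gt0.
have S01 : 0 <= \sum_j rho j `^ s < 1 by rewrite S0.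
have [c c01 rc] := ratio_uniform_lt1.
have [l1 l1P] := expr_lt_eventually c01 dD0.
have [l2 l2P] := expr_lt_eventually S01 eD0.
pose l := maxn l1 l2; pose U i := nth set0 [seq cyl w | w <- words l] i.
have wD w : w \in words l -> forall x y, cyl w x -> cyl w y -> edist x y <= rho_ w * D.
  by move=> _; exact: (cylinder_diam K_ss KD).
apply: (@le_trans _ _ (\sum_(0 <= i <oo) ediam_pow s (U i))%E).
  apply: ereal_inf_lbound; exists U => //; split.
    move=> x /(cylinder_word_ex K_ss l)[w wl wx].
    have ww : w \in words l by rewrite mem_words wl.
    exists (index w (words l)) => //.
    by rewrite /U (nth_map [::]) ?index_mem// nth_index.
  move=> i; have [il|il] := ltnP i (size (words l)); last first.
    rewrite /U nth_default ?size_map//; apply: ediam_le => x y [].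
  rewrite /U (nth_map [::])//; set w := nth _ _ _.
  have ww : w \in words l by exact: mem_nth.
  apply: ediam_le => x y wx wy; rewrite (le_trans (wD _ ww _ _ wx wy))//.
  rewrite -ler_pdivlMr// (le_trans (word_ratio_le w rc))//.
  by move: ww; rewrite mem_words => /eqP ->; rewrite ltW// l1P// leq_maxl.
rewrite (@nneseries_split _ _ _ (size (words l))); last first.
  by move=> i _; exact: ediam_pow_ge0.
rewrite add0n [X in (_ + X)%E]eseries0 ?adde0; last first.
  move=> i il _; rewrite /U nth_default ?size_map// /ediam_pow.
  by case: asboolP.
apply: (@le_trans _ _ (\sum_(0 <= i < size (words l))
    ((rho_ (nth [::] (words l) i) * D) `^ s)%:E)%E).
  rewrite !big_nat; apply: lee_sum => i /andP[_ il].
  have ww : nth [::] (words l) i \in words l by exact: mem_nth.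
  rewrite /U (nth_map [::])//; apply: ediam_pow_le => //.
    by rewrite mulr_ge0// ltW// (word_ratio_gt0 K_ss).
  by apply: ediam_le; exact: wD.
rewrite sumEFin lee_fin -(big_nth [::] xpredT (fun w => (rho_ w * D) `^ s)).
under eq_bigr do rewrite powRM ?(ltW D0) ?(ltW (word_ratio_gt0 K_ss _))// word_ratio_powR.
by rewrite -mulr_suml sum_words -ler_pdivlMr// ltW// l2P// leq_maxr.
Qed.

Lemma hausdorff_dim_le s : 0 <= s -> \sum_j rho j `^ s < 1 ->
  (hausdorff_dim K <= s%:E)%E.
Proof.
move=> s0 S1; apply: ereal_inf_lbound; exists s => //.
by split=> //; exact: hausdorff_measure_eq0.
Qed.

End Dimension.

(** * Lower bound for the Hausdorff dimension *)

Section DimensionLowerBound.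
Variables (R : realType) (n m : nat) (rho : 'I_m -> R).
Variables (g : 'I_m -> 'rV[R]_n -> 'rV[R]_n) (K : set 'rV[R]_n).
Hypothesis K_ss : self_similar rho g K.
Notation cyl := (cylinder g K).
Notation rho_ := (word_weight rho).

Lemma word_weight_le_ratio (p : 'I_m -> R) s w : (forall j, 0 < p j <= rho j `^ s) ->
  word_weight p w <= rho_ w `^ s.
Proof.
move=> pr; rewrite (word_ratio_powR K_ss); elim: w => [|j w IH].
  by rewrite !word_weight_nil.
have /andP[p0 prj] := pr j; rewrite !word_weight_cons; apply: ler_pM => //.
  exact: ltW.
by rewrite ltW// word_weight_gt0// => i; case/andP: (pr i).
Qed.

(** Mass distribution principle: descend through cylinders containing the part of [U] in [K] while
    [delta * rho_ w] exceeds the diameter [d] of [U]. When this fails, the weight is at most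
    [rho_ w ^ s <= (d / delta)^s]. The term [eta] handles [d = 0], where the descent never ends. *)
Lemma small_set_in_cylinder (p : 'I_m -> R) (s delta eta : R) (U : set 'rV[R]_n) :
  0 < delta -> gap_at_least g K delta -> 0 <= s -> (forall j, 0 < p j <= rho j `^ s) ->
  K `&` U !=set0 -> (ediam U <= 1)%E -> 0 < eta ->
  exists2 w, K `&` U `<=` cyl w &
    ((word_weight p w)%:E <= ((delta `^ s)^-1)%:E * ediam_pow s U + eta%:E)%E.
Proof.
move=> delta0 sep s0 pr [x [Kx Ux]] U1 eta0.
have U0 : (0 <= ediam U)%E by apply: ediam_ge0; exists x.
have Ufin : ediam U \is a fin_num.
  by rewrite ge0_fin_numE// (le_lt_trans U1)// ltry.
pose d := fine (ediam U); have UE : ediam U = d%:E by rewrite fineK.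
have d0 : 0 <= d by exact: fine_ge0.
have Ud y z : U y -> U z -> edist y z <= d.
  by move=> Uy Uz; rewrite -lee_fin -UE edist_le_ediam.
have -> : ediam_pow s U = (d `^ s)%:E.
  rewrite /ediam_pow UE poweR_EFin; case: asboolP => // Ue.
  by move: Ux; rewrite Ue.
suff [w wU w_le] : exists2 w, K `&` U `<=` cyl w &
    word_weight p w <= (delta `^ s)^-1 * d `^ s + eta.
  by exists w => //; rewrite -EFinM -EFinD lee_fin.
(* For exponent 0 the power of the diameter is 1, even when [d = 0], so the empty word works. *)
have [->|s_neq0] := eqVneq s 0.
  exists [::]; first by move=> y [].
  by rewrite word_weight_nil !powRr0 invr1 mul1r lerDl ltW.
have s_gt0 : 0 < s by rewrite lt_neqAle eq_sym s_neq0.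
have Cd0 : 0 <= (delta `^ s)^-1 * d `^ s by rewrite mulr_ge0 ?invr_ge0 ?powR_ge0.
have eta's : 0 < eta `^ s^-1 by rewrite powR_gt0.
(* Words of length [l] have weight at most [eta], so the descent may stop there. *)
have [l lP] := word_ratio_small K_ss eta's.
have [[w wU w_le]|[w wl wU]] : (exists2 w, K `&` U `<=` cyl w &
    word_weight p w <= (delta `^ s)^-1 * d `^ s) \/
    (exists2 w, size w = l & K `&` U `<=` cyl w).
- elim: l {lP} => [|l [[w wU w_le]|[w wl wU]]].
  + by right; exists [::] => // y [].
  + by left; exists w.
  have [dw|dw] := leP (delta * rho_ w) d.
    left; exists w => //; rewrite (le_trans (word_weight_le_ratio w pr))//.
    rewrite ler_pdivlMl ?powR_gt0// -powRM ?(ltW delta0) ?(ltW (word_ratio_gt0 K_ss w))//.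
    apply: ge0_ler_powR => //; rewrite nnegrE// mulr_ge0// ltW//.
    exact: (word_ratio_gt0 K_ss).
  right; have [j wx] := cylinder_rcons_ex K_ss (wU _ (conj Kx Ux)).
  exists (rcons w j); first by rewrite size_rcons wl.
  move=> y [Ky Uy]; apply: (cylinder_gap_rcons K_ss sep wx); first exact: wU.
  by rewrite (le_lt_trans (Ud _ _ Ux Uy)).
- by exists w => //; rewrite (le_trans w_le)// lerDl ltW.
exists w => //; rewrite (le_trans (word_weight_le_ratio w pr))//.
rewrite ler_wpDl//.
have -> : eta = (eta `^ s^-1) `^ s.
  by rewrite -powRrM mulVf// powRr1// ltW.
apply: ge0_ler_powR; rewrite ?nnegrE ?powR_ge0//.
  by rewrite ltW// (word_ratio_gt0 K_ss).
by rewrite ltW// lP.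
Qed.

Lemma hausdorff_measure_neq0 (s : R) : SSC g K -> 0 <= s -> 1 <= \sum_j rho j `^ s ->
  hausdorff_measure s K <> 0%E.
Proof.
move=> K_ssc s0 S1 H0; have [delta delta0 sep] := SSC_separated K_ss K_ssc.
set S := \sum_j _ in S1; have S0 : 0 < S by exact: lt_le_trans S1.
(* Dividing by [S >= 1] gives a probability vector that still satisfies [p j <= rho j ^ s]. *)
pose p j := rho j `^ s / S.
have p0 j : 0 < p j by rewrite divr_gt0// powR_gt0// (ratio_gt0 K_ss).
have pr j : 0 < p j <= rho j `^ s by rewrite p0/= ler_pdivrMr// ler_peMr// powR_ge0.
have p1 : \sum_j p j = 1 by rewrite -mulr_suml divff// gt_eqF.
pose C := (delta `^ s)^-1; have C0 : 0 < C by rewrite invr_gt0 powR_gt0.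
have content0 : (hausdorff_content s 1 K <= 0)%E.
  by rewrite -[leRHS]H0; apply: ereal_sup_ubound; exists 1 => /=.
(* A cover of cost below [1 / (4 * C)], with errors [2^-(i+2)], yields a finite cover by cylinders
   of total weight at most [1/4 + 1/2], which [cylinder_cover_weight] forbids. *)
have [_ [U [KU U1] <-]] : exists2 x,
    [set (\sum_(0 <= i <oo) ediam_pow s (U i))%E |
    U in [set U : nat -> set 'rV[R]_n |
      K `<=` \bigcup_i U i /\ forall i, (ediam (U i) <= 1%:E)%E]] x &
    (x < (4 * C)^-1%:E)%E.
  apply: ereal_inf_lt; apply: (le_lt_trans content0).
  by rewrite lte_fin invr_gt0 mulr_gt0.
set a := (\sum_(_ <= _ <oo) _)%E => a_lt.
pose I := [set i | K `&` U i !=set0].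
have /choice[w wP] : forall i, exists w, I i -> K `&` U i `<=` cyl w /\
    ((word_weight p w)%:E <= C%:E * ediam_pow s (U i) + (1 / 2 ^+ i.+2)%:E)%E.
  move=> i; have [Ii|nIi] := pselect (I i); last by exists [::].
  have [||w wU w_le] := @small_set_in_cylinder p s delta (1 / 2 ^+ i.+2) (U i)
    delta0 sep s0 pr Ii.
  - exact: U1.
  - by rewrite divr_gt0// exprn_gt0.
  by exists w.
have [|N NP] := @cylinder_finite_cover _ _ _ _ _ _ K_ss _ delta0 sep I w.
  move=> x Kx; have [i _ Ux] := KU _ Kx.
  have Ii : I i by exists x.
  by exists i => //; have [wU _] := wP i Ii; exact: wU.
have := @cylinder_cover_weight _ _ _ _ _ _ K_ss _ delta0 sep p
  [seq w i | i <- iota 0 N & `[< I i >]] p0 p1.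
rewrite big_map big_filter.
move=> /(_ _)/wrap[|].
  move=> x /NP[i [iN Ii wx]]; exists (w i) => //; apply: map_f.
  by rewrite mem_filter mem_iota iN; apply/andP; split=> //; exact/asboolP.
apply/negP; rewrite -ltNge -lte_fin -sumEFin.
apply: (@le_lt_trans _ _ (\sum_(0 <= i < N)
    (C%:E * ediam_pow s (U i) + (1 / 2 ^+ i.+2)%:E))%E).
  rewrite /index_iota subn0 big_mkcond/=; apply: lee_sum => i _.
  case: asboolP => [Ii|_]; first by case: (wP i Ii).
  rewrite adde_ge0 ?mule_ge0 ?ediam_pow_ge0 ?lee_fin ?ltW ?divr_gt0// exprn_gt0//.
rewrite big_split/= -ge0_sume_distrr; last by move=> i _; exact: ediam_pow_ge0.
have half : (\sum_(0 <= i < N) (1 / 2 ^+ i.+2)%:E <= (2^-1)%:E :> \bar R)%E.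
  rewrite sumEFin lee_fin.
  suff -> : \sum_(0 <= i < N) (1 / 2 ^+ i.+2) = 2^-1 - 1 / 2 ^+ N.+1 :> R.
    by rewrite lerBlDr lerDl divr_ge0// exprn_ge0.
  elim: N {NP} => [|N IH]; first by rewrite big_nil expr1 div1r subrr.
  by rewrite big_nat_recr//= IH !exprS; field; rewrite expf_neq0.
have aN : (\sum_(0 <= i < N) ediam_pow s (U i) <= a)%E.
  by apply: nneseries_lim_ge => i *; exact: ediam_pow_ge0.
apply: (@le_lt_trans _ _ (C%:E * (4 * C)^-1%:E + (2^-1)%:E)%E).
  apply: leeD => //; apply: lee_wpmul2l; first by rewrite lee_fin ltW.
  by rewrite (le_trans aN)// ltW.
rewrite -EFinM -EFinD lte_fin invfM mulrCA divff ?gt_eqF// mulr1; lra.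
Qed.

Lemma hausdorff_dim_ge (s : R) : SSC g K -> 0 <= s -> 1 <= \sum_j rho j `^ s ->
  (s%:E <= hausdorff_dim K)%E.
Proof.
move=> K_ssc s0 S1; apply: le_ereal_inf_tmp => _ [t /= [t0 Ht] <-].
rewrite lee_fin leNgt; apply/negP => ts; move: Ht.
apply: hausdorff_measure_neq0 => //; apply: le_trans S1 _; apply: ler_sum => j _.
apply: ger_powR; last exact: ltW.
by rewrite (ratio_gt0 K_ss) ltW// (ratio_lt1 K_ss).
Qed.

End DimensionLowerBound.

(* The solvability of the Moran equation of [K] is not presupposed: if the sum
   differed from 1, it would do so on the same side at a nearby exponent, which
   contradicts one of the two bounds on the dimension. *)
Lemma moran_equation (R : realType) (n m : nat) (rho : 'I_m -> R)
    (g : 'I_m -> 'rV[R]_n -> 'rV[R]_n) (K : set 'rV[R]_n) (s : R) :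
  self_similar rho g K -> SSC g K -> 0 < s -> hausdorff_dim K = s%:E ->
  \sum_j rho j `^ s = 1.
Proof.
move=> K_ss K_ssc s0 dimK.
have rho0 := ratio_gt0 K_ss; have rho_neq0 j : rho j != 0 by rewrite gt_eqF.
have rho1 := ratio_lt1 K_ss.
have [j d e /andP[_ de] jd|j|c c0 cP] := @finite_pos_lower_bound R _ (fun j e => e <= rho j).
- exact: le_trans de jd.
- by exists (rho j).
have m_gt0 : (0 < m)%N.
  case: K_ss => _ [x Kx] _; move: Kx => + KE; rewrite KE => -[i _ _].
  exact: leq_ltn_trans (ltn_ord i).
have c1 : c < 1 by exact: le_lt_trans (cP (Ordinal m_gt0)) (rho1 _).
set S := \sum_j _; have lnc : ln c < 0 by rewrite ln_lt0// c0.
(* As [c] is a lower bound of the ratios, raising the exponent by [t] multiplies each term by at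
   least [c ^ t]. *)
have shift t j : 0 <= t -> c `^ t * rho j `^ s <= rho j `^ (s + t).
  move=> t0; rewrite powRD; last by rewrite rho_neq0 implybT.
  rewrite mulrC ler_wpM2l ?powR_ge0//.
  by apply: ge0_ler_powR; rewrite ?nnegrE ?(ltW c0) ?(ltW (rho0 j)) ?cP.
have [S1|S1|//] := ltgtP S 1.
  have [S0|S0] := leP S 0.
    exfalso; move: S0; apply/negP; rewrite -ltNge.
    rewrite /S (bigD1 (Ordinal m_gt0))//= ltr_pwDl ?powR_gt0// sumr_ge0// => j _.
    exact: powR_ge0.
  (* The value [ln S / ln c] would give [c ^ t = S]; half of it gives the strict [S < c ^ t], and
     [s / 2] keeps [s - t] positive. *)
  pose t := Num.min (s / 2) (ln S / (2 * ln c)).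
  have t0 : 0 < t by rewrite lt_min divr_gt0//= ltr_ndivlMr ?mul0r ?ln_lt0 ?S0//; lra.
  have ts : t < s by rewrite gt_min; apply/orP; left; lra.
  have := @hausdorff_dim_le _ _ _ _ _ _ K_ss (s - t).
  rewrite dimK lee_fin => H; exfalso.
  suff /H : \sum_j rho j `^ (s - t) < 1 by lra.
  have ct : S < c `^ t.
    rewrite -ltr_ln ?posrE ?powR_gt0// ln_powR.
    have : ln S / (2 * ln c) * ln c <= t * ln c by rewrite ler_nM2r// ge_min lexx orbT.
    have lnS : ln S < 0 by rewrite ln_lt0// S0.
    have -> : ln S / (2 * ln c) * ln c = ln S / 2 by field; rewrite lt_eqF.
    lra.
  rewrite -(ltr_pM2l (powR_gt0 t c0)) mulr1 (le_lt_trans _ ct)// mulr_sumr.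
  apply: ler_sum => j _; rewrite powRD ?rho_neq0 ?implybT//.
  rewrite mulrCA ler_piMr ?powR_ge0// powRN ler_pdivrMr ?powR_gt0// mul1r.
  by apply: ge0_ler_powR; rewrite ?nnegrE ?(ltW c0) ?(ltW (rho0 j)) ?(ltW t0) ?cP.
(* This [t] solves [c ^ t * S = 1], so the Moran sum is still at least 1 at [s + t]. *)
exfalso; pose t := - ln S / ln c.
have lnS : 0 < ln S by rewrite ln_gt0.
have t0 : 0 < t by rewrite ltr_ndivlMr// mul0r; lra.
have := @hausdorff_dim_ge _ _ _ _ _ _ K_ss (s + t) K_ssc.
rewrite dimK lee_fin => H.
suff /H : 1 <= \sum_j rho j `^ (s + t) by lra.
have ctS : c `^ t * S = 1.
  apply: ln_inj; rewrite ?posrE ?mulr_gt0 ?powR_gt0//; first by lra.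
  rewrite lnM ?posrE ?powR_gt0//; last by lra.
  by rewrite ln_powR ln1 /t; field; rewrite lt_eqF.
rewrite -ctS mulr_sumr; apply: ler_sum => j _; apply: shift; exact: ltW.
Qed.

(** * Prefix codes and codings *)

Section Kraft.
Variable b : nat.
Implicit Types (t u : nat -> nat).

Fixpoint digits_value t n : nat :=
  if n is n'.+1 then (digits_value t n' * b + t n')%N else 0%N.

Lemma eq_digits_value t u n : (forall i, (i < n)%N -> t i = u i) ->
  digits_value t n = digits_value u n.
Proof.
elim: n => //= n IH tu; rewrite tu// IH// => i lin.
by apply: tu; exact: ltnW.
Qed.

Lemma digits_value_lt t n : (forall i, (t i < b)%N) -> (digits_value t n < b ^ n)%N.
Proof.
move=> tb; elim: n => //= n IH; rewrite expnSr.
apply: (@leq_trans ((digits_value t n).+1 * b)); last by rewrite leq_mul2r IH orbT.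
by rewrite mulSn addnC ltn_add2r.
Qed.

Lemma digits_value_inj t u n : (forall i, (t i < b)%N) -> (forall i, (u i < b)%N) ->
  digits_value t n = digits_value u n -> forall i, (i < n)%N -> t i = u i.
Proof.
move=> tb ub; have b0 : (0 < b)%N by exact: leq_ltn_trans (tb 0%N).
elim: n => // n IH /= tu i; rewrite ltnS leq_eqVlt => /predU1P[->|/IH]; last first.
  apply; have := congr1 (divn^~ b) tu.
  by rewrite !divnMDl// !divn_small// !addn0.
by have := congr1 (modn^~ b) tu; rewrite !modnMDl !modn_small.
Qed.

Lemma digits_value_div t n d : (forall i, (t i < b)%N) ->
  (digits_value t (n + d) %/ b ^ d)%N = digits_value t n.
Proof.
move=> tb; have b0 : (0 < b)%N by exact: leq_ltn_trans (tb 0%N).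
elim: d => [|d IH]; first by rewrite addn0 expn0 divn1.
by rewrite addnS/= expnS divnMA divnMDl// (divn_small (tb _)) addn0.
Qed.

Lemma digits_value_surj n a : (0 < b)%N -> (a < b ^ n)%N ->
  exists2 u, (forall i, (u i < b)%N) & digits_value u n = a.
Proof.
move=> b0 an; exists (fun i => (a %/ b ^ (n - i.+1)) %% b)%N.
  by move=> i; rewrite ltn_mod.
suff val l : (l <= n)%N -> digits_value (fun i => (a %/ b ^ (n - i.+1)) %% b)%N l =
    (a %/ b ^ (n - l))%N by rewrite val// subnn expn0 divn1.
elim: l => [|l IH] ln /=; first by rewrite subn0 divn_small.
rewrite IH 1?ltnW// [RHS](divn_eq _ b) -divnMA -expnSr.
by congr (_ %/ b ^ _ * b + _)%N; rewrite -subSn.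
Qed.

Lemma partial_sums_partition (T : eqType) (s : seq T) (L : T -> nat) N :
  (N < \sum_(i <- s) L i)%N -> uniq s ->
  exists2 j, j \in s & (\sum_(i <- take (index j s) s) L i <= N <
    \sum_(i <- take (index j s) s) L i + L j)%N.
Proof.
elim: s N => [|x s IH] N; first by rewrite big_nil.
rewrite big_cons /= => Nlt /andP[xs us].
have [Nx|xN] := ltnP N (L x).
  by exists x; rewrite ?mem_head// eqxx take0 big_nil.
have [|j js jN] := IH (N - L x)%N _ us; first by rewrite ltn_subLR.
exists j; first by rewrite inE js orbT.
have -> : (x == j) = false by apply: contraNF xs => /eqP ->.
rewrite /= big_cons -addnA; move: jN => /andP[j1 j2]; apply/andP; split.
  by rewrite -leq_subRL.
by rewrite -ltn_subLR.
Qed.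

Lemma partial_sums_disjoint (T : eqType) (s : seq T) (L : T -> nat) i j :
  i \in s -> (index i s < index j s)%N ->
  (\sum_(l <- take (index i s) s) L l + L i <= \sum_(l <- take (index j s) s) L l)%N.
Proof.
elim: s => //= x s IH; rewrite inE (eq_sym i).
have [<-|xi] := eqVneq x i => /= si; have [xj|xj] := eqVneq x j => //= ij.
  by rewrite big_nil add0n big_cons leq_addr.
by rewrite !big_cons -addnA leq_add2l IH.
Qed.

Definition is_prefix (p : nat) u t := forall i, (i < p)%N -> t i = u i.

(* Kraft's equality case: the words are the base-[b] expansions of the partial
   sums of [b ^- p j], taken in the order of increasing lengths. *)
Lemma kraft_prefix_code m (p : 'I_m -> nat) P :
  (0 < b)%N -> (forall j, (p j <= P)%N) -> (\sum_j b ^ (P - p j) = b ^ P)%N ->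
  exists u : 'I_m -> nat -> nat, (forall j i, (u j i < b)%N) /\
    forall t, (forall i, (t i < b)%N) ->
      exists j, is_prefix (p j) (u j) t /\
        forall j', is_prefix (p j') (u j') t -> j' = j.
Proof.
move=> b0 pP sumP; pose L j := (b ^ (P - p j))%N.
have L0 j : (0 < L j)%N by rewrite expn_gt0 b0.
pose s := sort (relpre p leq) (index_enum 'I_m).
have us : uniq s by rewrite sort_uniq index_enum_uniq.
have ms j : j \in s by rewrite mem_sort mem_index_enum.
pose S j := (\sum_(l <- take (index j s) s) L l)%N.
have sumL : (\sum_(i <- s) L i = b ^ P)%N.
  by rewrite -sumP; apply: perm_big; rewrite perm_sort.
(* Words are sorted by increasing length, so each earlier [L l] is a multiple of [L j], and
   [S j / L j] is an integer to be written with [p j] digits. *)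
have S_dvd j : (L j %| S j)%N.
  rewrite /S big_seq; apply: dvdn_sum => l /index_ltn lj; apply: dvdn_exp2l.
  apply: leq_sub2l; apply: (@sorted_ltn_index _ (relpre p leq)) lj => //.
    by move=> x y z /=; exact: leq_trans.
  by apply: sort_sorted => x y /=; exact: leq_total.
have S_le j : (S j + L j <= b ^ P)%N.
  rewrite -sumL -[X in (_ <= \sum_(i <- X) _)%N](cat_take_drop (index j s)) big_cat/=.
  by rewrite leq_add2l (drop_nth j) ?index_mem// nth_index// big_cons leq_addr.
have bPE j : (b ^ P = b ^ p j * L j)%N by rewrite -expnD subnKC.
have /choice[u uP] : forall j, exists u, (forall i, (u i < b)%N) /\
    digits_value u (p j) = (S j %/ L j)%N.
  move=> j; have [|u ub uE] := @digits_value_surj (p j) (S j %/ L j) b0.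
    rewrite ltn_divLR// -bPE (leq_trans _ (S_le j))// -addn1 leq_add2l; exact: L0.
  by exists u.
(* Fixing the first [p j] digits confines the value of the first [P] digits to an interval of length
   [L j]; unique parsing becomes the tiling of [[0, b^P)] by these intervals. *)
have prefix_itv t j : (forall i, (t i < b)%N) ->
    is_prefix (p j) (u j) t <-> (S j <= digits_value t P < S j + L j)%N.
  move=> tb; have [ub uE] := uP j.
  have tE := digits_value_div (p j) (P - p j) tb; rewrite subnKC// in tE.
  have -> : (S j <= digits_value t P < S j + L j)%N =
      (digits_value t (p j) == digits_value (u j) (p j)).
    rewrite uE -tE -{1 2}(divnK (S_dvd j)) -leq_divRL// -mulSnr -ltn_divLR//.
    by rewrite ltnS -eqn_leq eq_sym.
  split=> [tu|/eqP tu]; last exact: digits_value_inj tu.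
  by apply/eqP; exact: eq_digits_value.
exists u; split=> [j|t tb]; first by case: (uP j).
have [|j _ tj] := @partial_sums_partition _ s L (digits_value t P) _ us.
  by rewrite sumL digits_value_lt.
exists j; split=> [|j']; first exact/prefix_itv.
move=> /(prefix_itv _ _ tb) tj'.
have disj i i' : (index i s < index i' s)%N ->
    (S i <= digits_value t P < S i + L i)%N ->
    (S i' <= digits_value t P < S i' + L i')%N -> False.
  move=> /(partial_sums_disjoint L (ms i)) ii' /andP[_ ti] /andP[ti' _].
  by have := leq_trans ti (leq_trans ii' ti'); rewrite ltnn.
have [jj'|jj'|jj'] := ltngtP (index j s) (index j' s).
- by have := disj _ _ jj' tj tj'.
- by have := disj _ _ jj' tj' tj.
- by rewrite -(nth_index j (ms j)) jj' nth_index.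
Qed.

End Kraft.

(* [c x] is the sequence of base-[b] digits of [x]; it identifies [K], up to
   bilipschitz maps, with the digit sequences at distance [theta ^+ l] when [l]
   is the length of their longest common prefix. *)
Definition coding (R : realType) (n b : nat) (theta : R) (K : set 'rV[R]_n)
    (c : 'rV[R]_n -> nat -> nat) :=
  [/\ forall x i, K x -> (c x i < b)%N,
      exists2 C, 0 < C & forall x y l, K x -> K y -> is_prefix l (c y) (c x) ->
        edist x y <= C * theta ^+ l,
      exists2 d, 0 < d & forall x y l, K x -> K y -> edist x y < d * theta ^+ l ->
        is_prefix l (c y) (c x) &
      forall t, (forall i, (t i < b)%N) -> exists2 x, K x & c x =1 t].

(** * The digit sequence of a point of a self-similar set *)

Section Coding.
Variables (R : realType) (n m : nat) (rho : 'I_m -> R).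
Variables (g : 'I_m -> 'rV[R]_n -> 'rV[R]_n) (K : set 'rV[R]_n).
Hypothesis K_ss : self_similar rho g K.
Hypothesis K_ssc : SSC g K.
Variables (b : nat) (theta : R) (p : 'I_m -> nat) (u : 'I_m -> nat -> nat).
Hypothesis theta01 : 0 < theta < 1.
Hypothesis p_gt0 : forall j, (0 < p j)%N.
Hypothesis rhoE : forall j, rho j = theta ^+ p j.
Hypothesis u_lt : forall j i, (u j i < b)%N.
Hypothesis u_code : forall t, (forall i, (t i < b)%N) ->
  exists j, is_prefix (p j) (u j) t /\
    forall j', is_prefix (p j') (u j') t -> j' = j.

Variables (dig : 'rV[R]_n -> 'I_m) (sh : 'rV[R]_n -> 'rV[R]_n).
Hypothesis digP : forall x, K x -> K (sh x) /\ x = g (dig x) (sh x).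

Let theta_gt0 : 0 < theta. Proof. by case/andP: theta01. Qed.

(* The first argument is a fuel; each step consumes at least one digit. *)
Fixpoint code_rec fuel x i : nat :=
  if fuel is f.+1 then
    if (i < p (dig x))%N then u (dig x) i else code_rec f (sh x) (i - p (dig x))%N
  else 0%N.

Definition code x i := code_rec i.+1 x i.

Lemma code_recE f f' x i : (i < f)%N -> (i < f')%N -> code_rec f x i = code_rec f' x i.
Proof.
elim: f f' x i => // f IH [|f'] //= x i; rewrite !ltnS => lif lif'.
have [//|pi] := ltnP; have := p_gt0 (dig x) => p0.
by apply: IH; apply: leq_trans (_ : (i <= _)%N); rewrite // ltn_subrL p0 (leq_trans p0).
Qed.

Lemma codeE x i : code x i =
  if (i < p (dig x))%N then u (dig x) i else code (sh x) (i - p (dig x))%N.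
Proof.
rewrite {1}/code /=; case: ltnP => // pi; apply: code_recE => //.
by rewrite ltn_subrL p_gt0 (leq_trans (p_gt0 _) pi).
Qed.

Lemma code_prefix x : is_prefix (p (dig x)) (u (dig x)) (code x).
Proof. by move=> i ip; rewrite codeE ip. Qed.

Lemma code_sh x i : code x (p (dig x) + i)%N = code (sh x) i.
Proof. by rewrite codeE ltnNge leq_addr/= addKn. Qed.

Lemma code_lt x i : K x -> (code x i < b)%N.
Proof.
have [l il] := ubnP i; elim: l x i il => // l IH x i; rewrite ltnS => il Kx.
rewrite codeE; case: (ltnP i (p _)) => pi; first exact: u_lt.
apply: IH; last by case: (digP Kx).
by apply: leq_trans il; rewrite ltn_subrL p_gt0 (leq_trans (p_gt0 _) pi).
Qed.

Lemma edist_sh x y : K x -> K y -> dig x = dig y ->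
  edist x y = theta ^+ p (dig x) * edist (sh x) (sh y).
Proof.
move=> Kx Ky xy; have [_ {1}->] := digP Kx; have [_ {1}->] := digP Ky.
by rewrite -xy (edist_map K_ss) rhoE.
Qed.

(** If [l] exceeds the longest code word, a common prefix of length [l] fixes the first letter by
    unique parsing; removing its code word rescales the distance accordingly. For [l <= P] the
    diameter bound suffices, whence the constant [D / theta ^+ P]. *)
Lemma code_close_points :
  exists2 C, 0 < C & forall x y l, K x -> K y -> is_prefix l (code y) (code x) ->
    edist x y <= C * theta ^+ l.
Proof.
have [D D0 KD] := self_similar_bounded K_ss.
pose P := \max_j p j; have pP j : (p j <= P)%N by exact: leq_bigmax.
exists (D / theta ^+ P) => [|x y l]; first by rewrite divr_gt0// exprn_gt0.
have [N lN] := ubnP l; elim: N l x y lN => // N IH l x y; rewrite ltnS => lN Kx Ky xy.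
have [lP|lP] := leqP l P.
  rewrite (le_trans (KD _ _ Kx Ky))// mulrAC -mulrA ler_peMr ?(ltW D0)//.
  rewrite ler_pdivlMr ?exprn_gt0// mul1r.
  by have [_ theta1] := andP theta01; rewrite ler_wiXn2l// ltW.
have dxy : dig x = dig y.
  have [|j [_ jP]] := u_code (t := code x); first by move=> i; exact: code_lt.
  rewrite (jP _ (code_prefix (x := x))) (jP (dig y))// => i iy.
  by rewrite xy ?(code_prefix iy)// (leq_trans iy)// (leq_trans (pP _))// ltnW.
have pl : (p (dig x) <= l)%N by rewrite (leq_trans (pP _))// ltnW.
rewrite (edist_sh Kx Ky dxy) -(subnKC pl) exprD mulrCA ler_pM2l ?exprn_gt0//.
apply: IH.
- by apply: leq_trans lN; rewrite ltn_subrL p_gt0 (leq_trans (p_gt0 _) pl).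
- by case: (digP Kx).
- by case: (digP Ky).
by move=> i ip; rewrite -!code_sh dxy xy// -dxy -ltn_subRL.
Qed.

(** Points closer than the gap share their first letter, hence a whole code word; the inverse map
    expands the distance by [theta^-p], and induction applies. *)
Lemma close_points_code :
  exists2 d, 0 < d & forall x y l, K x -> K y -> edist x y < d * theta ^+ l ->
    is_prefix l (code y) (code x).
Proof.
have [d d0 sep] := SSC_separated K_ss K_ssc; exists d => // x y l.
have [N lN] := ubnP l; elim: N l x y lN => // N IH l x y; rewrite ltnS => lN Kx Ky xy.
have [theta0 theta1] := andP theta01.
have [Kx' xE] := digP Kx; have [Ky' yE] := digP Ky.
have dxy : dig x = dig y.
  apply: (separated_digit sep Kx' Ky'); rewrite -xE -yE (lt_le_trans xy)//.
  by rewrite ler_piMr ?(ltW d0)// exprn_ile1 ?ltW.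
move=> i il; rewrite (codeE x) (codeE y) dxy; case: (ltnP i (p _)) => [//|pi].
have pl : (p (dig x) <= l)%N by rewrite dxy (leq_trans pi)// ltnW.
apply: (IH (l - p (dig x))%N) => //.
- by apply: leq_trans lN; rewrite ltn_subrL p_gt0 (leq_trans (p_gt0 _) pl).
- move: xy; rewrite (edist_sh Kx Ky dxy) -{1}(subnKC pl) exprD mulrCA.
  by rewrite ltr_pM2l ?exprn_gt0.
- by rewrite dxy ltn_sub2r// (leq_ltn_trans pi).
Qed.

Lemma code_surj t : (forall i, (t i < b)%N) -> exists2 x, K x & code x =1 t.
Proof.
have [delta delta0 sep] := SSC_separated K_ss K_ssc.
(* [J t] is the letter whose code word begins [t], and arbitrary if [t] is not a digit sequence.
   Repeated parsing yields the address [path], whose nested cylinders share the required point. *)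
have /choice[J JP] : forall t, exists j, (forall i, (t i < b)%N) ->
    is_prefix (p j) (u j) t.
  move=> s; have [sb|nsb] := pselect (forall i, (s i < b)%N).
    by have [j [js _]] := u_code sb; exists j.
  by have [_ [x Kx] _ _] := K_ss; exists (dig x) => /nsb.
pose tail t i := t (p (J t) + i)%N.
pose path := fix path l t := if l is l'.+1 then J t :: path l' (tail t) else [::].
move=> tb; have [|x xP] := @cylinder_nested _ _ _ _ _ _ K_ss _ delta0 sep (path ^~ t).
  move=> l; elim: l t {tb} => [|l IH] t; first exact: (cylinder_sub K_ss).
  by move=> _ [y wy <-]; exists y => //; exact: IH.
exists x; first exact: (xP 0%N).
move=> i; have [N iN] := ubnP i.
elim: N i t x iN tb xP => // N IH i t x; rewrite ltnS => iN tb xP.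
have [Kx xE] := digP (xP 0%N).
have [y Ky yx] := xP 1%N.
have dx : dig x = J t by apply: (separated_digit sep Kx Ky); rewrite -xE yx edistxx.
rewrite codeE; case: ltnP => pi; first by rewrite (JP t)// -?dx.
rewrite (IH _ (tail t)).
- by rewrite /tail -dx subnKC.
- by apply: leq_trans iN; rewrite ltn_subrL p_gt0 (leq_trans (p_gt0 _) pi).
- by move=> l; exact: tb.
move=> l; have [z zl zx] := xP l.+1.
suff <- : z = sh x by [].
by apply: (map_inj K_ss (i := J t)); rewrite zx -dx -xE.
Qed.

Lemma code_coding : coding b theta K code.
Proof.
split; [exact: code_lt | exact: code_close_points | exact: close_points_code
  | exact: code_surj].
Qed.

End Coding.

Lemma self_similar_coding (R : realType) (n m : nat) (rho : 'I_m -> R)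
    (g : 'I_m -> 'rV[R]_n -> 'rV[R]_n) (K : set 'rV[R]_n)
    (b : nat) (theta : R) (p : 'I_m -> nat) :
  self_similar rho g K -> SSC g K -> (0 < b)%N -> 0 < theta < 1 ->
  (forall j, (0 < p j)%N /\ rho j = theta ^+ p j) ->
  \sum_j (b%:R : R) ^- p j = 1 ->
  exists c, coding b theta K c.
Proof.
move=> K_ss K_ssc b0 theta01 pP sum1.
pose P := \max_j p j; have p_le j : (p j <= P)%N by exact: leq_bigmax.
(* The Moran equation multiplied by [b ^ P], as an identity between naturals. *)
have kraft_sum : (\sum_j b ^ (P - p j) = b ^ P)%N.
  apply/eqP; rewrite -(eqr_nat R) natr_sum natrX -[X in _ == X]mul1r.
  rewrite -[X in _ == X * _]sum1 mulr_suml.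
  apply/eqP/eq_bigr => j _; rewrite natrX -[in RHS](subnK (p_le j)) exprD mulrC.
  by rewrite mulfK// expf_neq0// pnatr_eq0 -lt0n.
have [u [u_lt u_code]] := kraft_prefix_code b0 p_le kraft_sum.
have [dig_sh dsP] : exists ds : 'rV[R]_n -> 'I_m * 'rV[R]_n,
    forall x, K x -> K (ds x).2 /\ x = g (ds x).1 (ds x).2.
  suff /choice[ds dsP] : forall x, exists ds, K x -> K ds.2 /\ x = g ds.1 ds.2.
    by exists ds.
  move=> x; have [Kx|nKx] := pselect (K x).
    by have [i [y xy]] := self_similar_preimage K_ss Kx; exists (i, y).
  have [_ [x0 /(self_similar_preimage K_ss)[i _]] _ _] := K_ss.
  by exists (i, x) => /nKx.
exists (code p u (fst \o dig_sh) (snd \o dig_sh)).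
by apply: (code_coding K_ss K_ssc) => // j; case: (pP j).
Qed.

(** * Bilipschitz maps between coded sets *)

Section CodedSets.
Variables (R : realType) (b : nat) (theta : R).
Hypothesis theta01 : 0 < theta < 1.

Lemma coding_inj n (K : set 'rV[R]_n) c x y : coding b theta K c ->
  K x -> K y -> (forall l, is_prefix l (c y) (c x)) -> x = y.
Proof.
move=> [_ [C C0 CP] _ _] Kx Ky cxy; apply: contrapT => /edist_gt0 xy0.
have [/andP[theta0 theta1] xyC0] := (theta01, divr_gt0 xy0 C0).
have theta01' : 0 <= theta < 1 by rewrite ltW.
have [N /(_ N (leqnn N))] := expr_lt_eventually theta01' xyC0.
by rewrite ltr_pdivlMr// mulrC ltNge CP.
Qed.

(** If [l] is the exact length of the common prefix, the images are within [C * theta ^+ l] and the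
    points at least [d * theta ^+ l.+1] apart; the extra digit accounts for [theta] in the
    constant. *)
Lemma coding_lipschitz n1 n2 (A : set 'rV[R]_n1) (B : set 'rV[R]_n2) cA cB
    (h : 'rV[R]_n1 -> 'rV[R]_n2) :
  coding b theta A cA -> coding b theta B cB ->
  (forall x, A x -> B (h x) /\ cB (h x) =1 cA x) -> elipschitz_on A h.
Proof.
move=> codA [_ [C C0 CP] _ _] hP; have [_ _ [d d0 dP] _] := codA.
have /andP[theta0 theta1] := theta01.
exists (C / (d * theta)) => x y Ax Ay.
have [Bx cx] := hP _ Ax; have [By cy] := hP _ Ay.
have [->|/eqP xy] := eqVneq x y; first by rewrite !edistxx mulr0.
have [l [xyl xyl']] : exists l, is_prefix l (cA y) (cA x) /\
    ~ is_prefix l.+1 (cA y) (cA x).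
  apply: contrapT => /forallNP nl; apply: xy; apply: (coding_inj codA) => //.
  elim=> [//|l IH]; apply: contrapT => nl'; exact: (nl l).
have hxy : edist (h x) (h y) <= C * theta ^+ l.
  by apply: CP => // i il; rewrite cx cy xyl.
have dxy : d * theta ^+ l.+1 <= edist x y.
  by rewrite leNgt; apply/negP => /(dP _ _ _ Ax Ay).
rewrite (le_trans hxy)// mulrAC ler_pdivlMr ?mulr_gt0// -mulrA ler_pM2l//.
by rewrite mulrCA -exprSr.
Qed.

Lemma coding_bilipschitz n1 n2 (A : set 'rV[R]_n1) (B : set 'rV[R]_n2) cA cB :
  coding b theta A cA -> coding b theta B cB -> bilipschitz_equivalent A B.
Proof.
move=> codA codB; have [A_lt _ _ A_surj] := codA; have [B_lt _ _ B_surj] := codB.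
have /choice[h hP] : forall x, exists y, A x -> B y /\ cB y =1 cA x.
  move=> x; have [Ax|nAx] := pselect (A x); last by exists 0.
  by have [y By yx] := B_surj (cA x) (A_lt x ^~ Ax); exists y.
have /choice[h' h'P] : forall y, exists x, B y -> A x /\ cA x =1 cB y.
  move=> y; have [By|nBy] := pselect (B y); last by exists 0.
  by have [x Ax xy] := A_surj (cB y) (B_lt y ^~ By); exists x.
have hK x : A x -> h' (h x) = x.
  move=> Ax; have [Bhx hx] := hP _ Ax; have [Ah'hx h'hx] := h'P _ Bhx.
  by apply: (coding_inj codA) => // l i _; rewrite h'hx hx.
have h'K y : B y -> h (h' y) = y.
  move=> By; have [Ah'y h'y] := h'P _ By; have [Bhh'y hh'y] := hP _ Ah'y.
  by apply: (coding_inj codB) => // l i _; rewrite hh'y h'y.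
exists h, h'; split.
- split.
  + by move=> x /hP[].
  + by move=> x y; rewrite !inE => /hK {2}<- /hK {2}<- ->.
  + by move=> y By; exists (h' y); [case: (h'P _ By) | exact: h'K].
- exact: hK.
- exact: coding_lipschitz codA codB hP.
- exact: coding_lipschitz codB codA h'P.
Qed.

End CodedSets.

(** * Lipschitz images of homogeneous sets *)

Section MeetCount.
Variables (R : realType) (n q : nat) (r : R).
Variables (f : 'I_q -> 'rV[R]_n -> 'rV[R]_n) (A : set 'rV[R]_n).
Hypothesis A_ss : self_similar (fun=> r) f A.
Variable D : R.
Hypothesis AD : forall x y, A x -> A y -> edist x y <= D.
Implicit Type S : set 'rV[R]_n.

(* The number of cylinders of length [l] of [A] that meet [S]. *)
Fixpoint meet_count l S : nat :=
  if l is l'.+1 then \sum_(i < q) meet_count l' (f i @^-1` S)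
  else `[< A `&` S !=set0 >].

(** For [e = r ^+ l * D], every cylinder of length [l] of [A] lies in [S] or misses it. *)
Definition resolved (e : R) S :=
  forall x y, A x -> A y -> S x -> edist x y <= e -> S y.

Lemma meet_count_gt0 l S : A `&` S !=set0 -> (0 < meet_count l S)%N.
Proof.
elim: l S => [|l IH] S AS /=; first by case: asboolP.
have [x [/(self_similar_preimage A_ss)[i [y [Ay xE]]] Sx]] := AS.
rewrite (bigD1 i)//= ltn_addr// IH//; exists y; split=> //=.
by rewrite -xE.
Qed.

Lemma meet_count_le l S : (meet_count l S <= q ^ l)%N.
Proof.
elim: l S => [|l IH] S /=; first by rewrite expn0 leq_b1.
rewrite expnS (@leq_trans (\sum_(i < q) q ^ l))//; last first.
  by rewrite sum_nat_const card_ord.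
by apply: leq_sum => i _.
Qed.

Lemma resolved_preimage e S i : 0 < r -> resolved (r * e) S -> resolved e (f i @^-1` S).
Proof.
move=> r0 Se x y Ax Ay Sx xy; apply: Se Sx _; try exact: (self_similar_image A_ss).
by rewrite (edist_map A_ss) ler_pM2l.
Qed.

Lemma resolved_dichotomy S : resolved D S -> A `<=` S \/ A `&` S = set0.
Proof.
move=> SD; have [[x [Ax Sx]]|/nonemptyPn] := pselect (A `&` S !=set0); last by right.
by left=> y Ay; apply: (SD x y) => //; exact: AD.
Qed.

(** All [q] children of a counted cylinder are counted, since it lies inside [S]. Hence the count
    divided by [q ^ l] no longer depends on [l]. *)
Lemma meet_count_succ l S : 0 < r -> resolved (r ^+ l * D) S ->
  meet_count l.+1 S = (q * meet_count l S)%N.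
Proof.
move=> r0; elim: l S => [|l IH] S.
  rewrite expr0 mul1r => /resolved_dichotomy[AS|AS] /=.
    have [_ [x Ax] _ _] := A_ss.
    rewrite (eq_bigr (fun=> 1%N)) => [|i _].
      rewrite sum_nat_const card_ord; case: asboolP => [_ //|[]].
      by exists x; split=> //; exact: AS.
    case: asboolP => [_ //|[]]; exists x; split=> //.
    by apply: AS; exact: (self_similar_image A_ss).
  rewrite big1 => [|i _].
    by case: asboolP; rewrite ?muln0// AS => -[].
  case: asboolP => // -[x [Ax fx]].
  suff : (A `&` S) (f i x) by rewrite AS.
  by split=> //; exact: (self_similar_image A_ss).
move=> Se; rewrite /= big_distrr; apply: eq_bigr => i _; apply: IH.
by apply: resolved_preimage => //; rewrite mulrA -exprS.
Qed.

(** A cylinder of length [l] that meets [S] meets some [T j], hence lies in it and misses the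
    others. *)
Lemma meet_count_additive (J : finType) (T : J -> set 'rV[R]_n) l S :
  0 < r -> (forall j, resolved (r ^+ l * D) (T j)) ->
  (forall x, A x -> S x -> exists j, T j x) -> (forall j, T j `<=` S) ->
  (forall i j x, T i x -> T j x -> i = j) ->
  meet_count l S = (\sum_j meet_count l (T j))%N.
Proof.
move=> r0; elim: l S T => [|l IH] S T Te ST TS T_disj.
  have [_ [x Ax] _ _] := A_ss; move: Te; rewrite expr0 mul1r => Te.
  rewrite /=; case: asboolP => [[y [Ay Sy]]|nS].
    have [j Tjy] := ST y Ay Sy.
    have AT z : A z -> T j z by move=> Az; apply: (Te j y z) => //; exact: AD.
    rewrite (bigD1 j)//= big1 => [|i ij].
      by case: asboolP => [_ //|[]]; exists x; split=> //; exact: AT.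
    case: asboolP => // -[z [Az Tiz]].
    by move: ij; rewrite (T_disj _ _ z Tiz (AT _ Az)) eqxx.
  rewrite big1// => j _; case: asboolP => // -[z [Az Tz]].
  by exfalso; apply: nS; exists z; split=> //; exact: TS Tz.
rewrite /= exchange_big/=; apply: eq_bigr => i _; apply: IH.
- by move=> j; apply: resolved_preimage => //; rewrite mulrA -exprS.
- by move=> x Ax; apply: ST; exact: (self_similar_image A_ss).
- by move=> j x; exact: TS.
- by move=> j j' x; exact: T_disj.
Qed.

End MeetCount.

(** * Comparison of weight and mass on the cylinders of [B] *)

Section LipschitzImage.
Variables (R : realType) (n1 n2 q m : nat) (r s : R) (rho : 'I_m -> R).
Variables (f : 'I_q -> 'rV[R]_n1 -> 'rV[R]_n1) (A : set 'rV[R]_n1).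
Variables (g : 'I_m -> 'rV[R]_n2 -> 'rV[R]_n2) (B : set 'rV[R]_n2).
Variables (h : 'rV[R]_n1 -> 'rV[R]_n2) (C D delta : R).
Hypothesis q_gt1 : (1 < q)%N.
Hypothesis A_ss : self_similar (fun=> r) f A.
Hypothesis AD : forall x y, A x -> A y -> edist x y <= D.
Hypothesis B_ss : self_similar rho g B.
Hypothesis B_sep : gap_at_least g B delta.
Hypotheses (C_gt0 : 0 < C) (D_gt0 : 0 < D) (delta_gt0 : 0 < delta).
Hypothesis hAB : h @` A = B.
Hypothesis h_lip : forall x y, A x -> A y -> edist (h x) (h y) <= C * edist x y.
Hypotheses (s_gt0 : 0 < s) (qrs : q%:R * r `^ s = 1).
Hypothesis sum_rho : \sum_j rho j `^ s = 1.

Notation cyl := (cylinder g B).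
Notation rho_ := (word_weight rho).
Let p j := rho j `^ s.
Notation p_ := (word_weight p).

Let q_gt0 : (0 < q)%N. Proof. exact: ltnW. Qed.
Let qR_gt0 : 0 < q%:R :> R. Proof. by rewrite ltr0n. Qed.
Let r_gt0 : 0 < r. Proof. exact: (ratio_gt0 A_ss (Ordinal q_gt0)). Qed.
Let r_lt1 : r < 1. Proof. exact: (ratio_lt1 A_ss (Ordinal q_gt0)). Qed.
Let p_gt0 j : 0 < p j. Proof. by rewrite powR_gt0// (ratio_gt0 B_ss). Qed.
Let pw_gt0 w : 0 < p_ w. Proof. exact: word_weight_gt0. Qed.

(** At this depth the image under [h] of a cylinder of [A] is too small to leave the cylinder of [w]
    once it meets it. *)
Definition resolving w l := r ^+ l * (C * D) < delta * rho_ w.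

Lemma resolving_resolved w l : resolving w l -> resolved A (r ^+ l * D) (h @^-1` cyl w).
Proof.
move=> wl x y Ax Ay wx xy; have Bhy : B (h y) by rewrite -hAB; exists y.
apply: (cylinder_gap B_ss delta_gt0 B_sep wx Bhy).
rewrite (le_lt_trans (h_lip Ax Ay))// (le_lt_trans _ wl)//.
by rewrite mulrCA ler_pM2l.
Qed.

Lemma resolving_ex w : exists N, forall l, (N <= l)%N -> resolving w l.
Proof.
have e0 : 0 < delta * rho_ w / (C * D).
  by rewrite divr_gt0 ?mulr_gt0// (word_ratio_gt0 B_ss).
have r01 : 0 <= r < 1 by rewrite ltW//= r_lt1.
have [N NP] := expr_lt_eventually r01 e0; exists N => l /NP.
by rewrite ltr_pdivlMr ?mulr_gt0.
Qed.

Lemma resolving_cat w v l : resolving (w ++ v) l -> resolving w l.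
Proof.
move=> wvl; apply: lt_le_trans wvl _; rewrite ler_pM2l// word_weight_cat.
rewrite ler_piMr//; first by rewrite ltW// (word_ratio_gt0 B_ss).
apply: word_weight_le1 => j; rewrite (ratio_gt0 B_ss)/=.
by rewrite ltW// (ratio_lt1 B_ss).
Qed.

Lemma resolving_exb w : exists l, `[< resolving w l >].
Proof. by have [N NP] := resolving_ex w; exists N; apply/asboolP/NP. Qed.

Definition level w := ex_minn (resolving_exb w).

Lemma level_resolving w : resolving w (level w).
Proof. by rewrite /level; case: ex_minnP => l /asboolP. Qed.

Lemma level_le w l : resolving w l -> (level w <= l)%N.
Proof. by move=> wl; rewrite /level; case: ex_minnP => l' _; apply; exact/asboolP. Qed.

Lemma resolving_le w l l' : (l <= l')%N -> resolving w l -> resolving w l'.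
Proof.
move=> ll'; apply: le_lt_trans; rewrite ler_pM2r ?mulr_gt0//.
by rewrite ler_wiXn2l// ltW.
Qed.

Definition hit_count w := meet_count f A (level w) (h @^-1` cyl w).

(* The push-forward under [h] of the uniform measure on [A]. *)
Definition mass w : R := (hit_count w)%:R / q%:R ^+ level w.

(** Any deeper level may replace the least one, so a word and its children can be put over one
    denominator. *)
Lemma massE w l : resolving w l ->
  mass w = (meet_count f A l (h @^-1` cyl w))%:R / q%:R ^+ l.
Proof.
move=> /level_le /subnKC <-; elim: (l - level w)%N => [|d IH]; first by rewrite addn0.
have wd : resolving w (level w + d).
  by apply: resolving_le (level_resolving w); exact: leq_addr.
rewrite IH addnS (meet_count_succ A_ss AD)//; last exact: resolving_resolved.
by rewrite natrM exprS invfM mulrACA divff ?mul1r// gt_eqF.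
Qed.

Lemma hit_count_gt0 w : (0 < hit_count w)%N.
Proof.
apply: (meet_count_gt0 A_ss); have [y wy] := cylinder_neq0 B_ss w.
have [x Ax hx] : (h @` A) y by rewrite hAB; exact: (cylinder_sub B_ss wy).
by exists x; split=> //=; rewrite hx.
Qed.

Lemma mass_gt0 w : 0 < mass w.
Proof. by rewrite divr_gt0 ?exprn_gt0// ltr0n hit_count_gt0. Qed.

Lemma mass_le1 w : mass w <= 1.
Proof.
by rewrite ler_pdivrMr ?exprn_gt0// mul1r -natrX ler_nat meet_count_le.
Qed.

Lemma mass_split w : mass w = \sum_j mass (rcons w j).
Proof.
have /choice[N NP] : forall j, exists N, forall l, (N <= l)%N -> resolving (rcons w j) l.
  by move=> j; exact: resolving_ex.
have [N0 N0P] := resolving_ex w.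
pose l := maxn N0 (\max_j N j).
have wl : resolving w l by apply: N0P; exact: leq_maxl.
have wjl j : resolving (rcons w j) l.
  by apply: NP; apply: leq_trans (leq_maxr _ _); exact: leq_bigmax.
rewrite (massE wl); under eq_bigr do rewrite (massE (wjl _)).
rewrite -mulr_suml -natr_sum; congr (_%:R / _).
apply: (meet_count_additive A_ss AD (T := fun j => h @^-1` cyl (rcons w j)) r_gt0).
- by move=> j; exact: resolving_resolved.
- by move=> x _ /(cylinder_rcons_ex B_ss).
- by move=> j x; exact: (cylinder_rcons_sub B_ss).
- by move=> i j x; exact: (cylinder_rcons_inj B_ss delta_gt0 B_sep).
Qed.

Lemma p_split w : p_ w = \sum_j p_ (rcons w j).
Proof. by under eq_bigr do rewrite word_weight_rcons; rewrite -mulr_sumr sum_rho mulr1. Qed.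

Definition level_bound := 1 + q%:R * ((C * D) / delta) `^ s.

(** If the level is [l + 1], then [l] does not resolve [w], so [delta * rho_ w <= r ^+ l * (C * D)];
    the power [s] turns [r] into [1 / q]. The summand 1 of [level_bound] covers level 0. *)
Lemma weight_level_le w : p_ w * q%:R ^+ level w <= level_bound.
Proof.
have p1 : p_ w <= 1.
  apply: word_weight_le1 => j; rewrite p_gt0/=.
  rewrite -sum_rho (bigD1 j)//= lerDl sumr_ge0// => i _; exact: powR_ge0.
have Q0 : 0 <= q%:R * ((C * D) / delta) `^ s by rewrite mulr_ge0 ?powR_ge0.
case E : (level w) => [|l]; first by rewrite expr0 mulr1 (le_trans p1)// lerDl.
have : ~ resolving w l by move=> /level_le; rewrite E ltnn.
move=> /negP; rewrite -leNgt => wl.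
suff : p_ w * q%:R ^+ l <= (C * D / delta) `^ s.
  rewrite -(ler_pM2l qR_gt0) exprS mulrCA => /le_trans; apply.
  by rewrite lerDr.
have qrl : q%:R ^+ l = ((r ^+ l) `^ s)^-1.
  rewrite -powR_mulrn ?(ltW r_gt0)// powRAC powR_mulrn ?powR_ge0// -exprVn.
  have rs0 : r `^ s != 0 by rewrite gt_eqF ?powR_gt0.
  by congr (_ ^+ _); apply: (mulIf rs0); rewrite qrs mulVf.
rewrite qrl ler_pdivrMr ?powR_gt0 ?exprn_gt0// -powRM ?exprn_ge0 ?(ltW r_gt0)//; last first.
  by rewrite divr_ge0 ?mulr_ge0 ?ltW.
rewrite -(word_ratio_powR B_ss); apply: ge0_ler_powR; rewrite ?(ltW s_gt0)//.
- by rewrite nnegrE ltW// (word_ratio_gt0 B_ss).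
- by rewrite nnegrE ltW// mulr_gt0 ?exprn_gt0// divr_gt0// mulr_gt0.
by rewrite mulrAC ler_pdivlMr// mulrC (mulrC (C * D)).
Qed.

Lemma weight_le_mass w : p_ w / mass w <= level_bound.
Proof.
rewrite ler_pdivrMr ?mass_gt0// -[leLHS]mulr1.
have qw : 0 < q%:R ^+ level w :> R by rewrite exprn_gt0.
rewrite mulrA ler_pdivlMr// mulr1 (le_trans (weight_level_le w))//.
rewrite ler_peMr//; last by rewrite ler1n hit_count_gt0.
by rewrite addr_ge0 ?mulr_ge0 ?powR_ge0.
Qed.

(* A word whose weight/mass quotient is close to the supremum transmits this
   property to its extensions, since the defects are nonnegative and additive. *)
Lemma nearly_proportional : exists2 M, 1 <= M & forall e, 0 < e -> exists w, forall v,
  p_ (w ++ v) <= M * mass (w ++ v) <= p_ (w ++ v) + e * p_ w.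
Proof.
pose E := [set p_ w / mass w | w in [set: seq 'I_m]].
have E_ub : has_ubound E by exists level_bound => _ [w _ <-]; exact: weight_le_mass.
have E_sup : has_sup E by split=> //; exists (p_ [::] / mass [::]), [::].
pose M := sup E.
have p_le w : p_ w <= M * mass w.
  by rewrite -ler_pdivrMr ?mass_gt0//; apply: ub_le_sup => //; exists w.
have M1 : 1 <= M.
  have := p_le [::]; rewrite word_weight_nil => /le_trans; apply.
  have M0 : 0 < M.
    rewrite -(pmulr_lgt0 _ (mass_gt0 [::])); exact: lt_le_trans (pw_gt0 [::]) (p_le _).
  by rewrite ler_piMr ?mass_le1// ltW.
have M0 : 0 < M by exact: lt_le_trans M1.
exists M => // e e0.
(* A quotient above [M / (1 + e)] means [M * mass w < (1 + e) * p_ w]. *)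
have e'0 : 0 < M - M / (1 + e).
  by rewrite subr_gt0 ltr_pdivrMr ?ltr_pMr ?ltrDl// addr_gt0.
have [_ [w _ <-] w_gt] := sup_adherent e'0 E_sup.
exists w; elim/last_ind => [|v j IH]; rewrite p_le/=.
  rewrite cats0; move: w_gt; rewrite -/M subKr ltr_pdivlMr ?mass_gt0//.
  by rewrite mulrAC ltr_pdivrMr ?addr_gt0// mulrDr mulr1 (mulrC e) => /ltW.
rewrite -rcons_cat -lerBlDl; apply: le_trans (_ : M * mass (w ++ v) - p_ (w ++ v) <= _).
  rewrite (mass_split (w ++ v)) (p_split (w ++ v)) mulr_sumr -sumrB.
  rewrite (bigD1 j)//= lerDl sumr_ge0// => i _.
  by rewrite subr_ge0.
by case/andP: IH => _; rewrite lerBlDl.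
Qed.

Lemma level_cat w v : (level w <= level (w ++ v))%N.
Proof. exact/level_le/resolving_cat/level_resolving. Qed.

Lemma hit_countE w : (hit_count w)%:R = mass w * q%:R ^+ level w.
Proof. by rewrite divfK// gt_eqF// exprn_gt0. Qed.

(* The bound [K] on the numerators does not depend on [L]. *)
Lemma approximate_relations (j : 'I_m) (L : nat) :
  exists K E : nat, K = Num.bound (2 * level_bound) /\ forall e, 0 < e -> exists t : {ffun 'I_L.+1 -> 'I_K.+1 * 'I_E.+1}, forall l : 'I_L.+1,
    (0 < (t l).1)%N /\
    `|(t l).1%:R / ((t ord0).1%:R * q%:R ^+ (t l).2) - p j ^+ l| <= e.
Proof.
have x0 := p_gt0 j; set x := p j in x0 *.
have x1 : x <= 1.
  by rewrite -sum_rho (bigD1 j)//= lerDl sumr_ge0// => i _; exact: powR_ge0.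
have lb0 : 0 <= level_bound by rewrite addr_ge0 ?mulr_ge0 ?powR_ge0.
(* [K] will bound the hit counts: as [M >= 1], the mass of [v l] is at most twice its weight, and
   [weight_level_le] applies. *)
have K_gt : 2 * level_bound < (Num.bound (2 * level_bound))%:R.
  by apply: archi_boundP; rewrite mulr_ge0.
set K := Num.bound _ in K_gt *; exists K.
have xL0 : 0 < x ^+ L by rewrite exprn_gt0.
(* [E] will bound the growth of the level from [w] to [v l]: the mass of [v l] is at least
   [x ^+ L / 2] times that of [w], so [q] to that growth is at most [2 * K / x ^+ L]. *)
have E_gt : 2 * K%:R / x ^+ L < (Num.bound (2 * K%:R / x ^+ L))%:R.
  by apply: archi_boundP; rewrite divr_ge0 ?mulr_ge0 ?(ltW xL0).
set E := Num.bound _ in E_gt *; exists E; split=> // e e0.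
(* A precision of at most [x ^+ L] keeps the error below the weight [x ^+ l * p_ w] of [v l], or
   equal to it, for all [l <= L]. *)
have [M M1 /(_ (Num.min e (x ^+ L)))] := nearly_proportional.
rewrite lt_min e0 xL0; set e1 := Num.min _ _ => -[//|w wP].
have e1e : e1 <= e by rewrite ge_min lexx.
have e1x : e1 <= x ^+ L by rewrite ge_min lexx orbT.
have e10 : 0 < e1 by rewrite lt_min e0 xL0.
pose v l := w ++ nseq l j.
have M0 : 0 < M by exact: lt_le_trans M1.
have pw0 := pw_gt0 w.
have vP l : x ^+ l * p_ w <= M * mass (v l) <= (x ^+ l + e1) * p_ w.
  by have := wP (nseq l j); rewrite word_weight_cat word_weight_nseq mulrDl mulrC.
have wP0 : p_ w <= M * mass w <= (1 + e1) * p_ w.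
  by have := vP 0%N; rewrite /v cats0 expr0 mul1r.
have x_le l : (l <= L)%N -> x ^+ L <= x ^+ l by move=> lL; rewrite ler_wiXn2l// ltW.
have e1_le l : (l <= L)%N -> e1 <= x ^+ l by move=> /x_le; exact: le_trans.
have xl1 l : x ^+ l <= 1 by rewrite exprn_ile1// ltW.
have hit_count_lt l : (l <= L)%N -> (hit_count (v l) < K.+1)%N.
  move=> lL; rewrite -(ltr_nat R) (lt_trans (le_lt_trans _ K_gt))// ?ltr_nat//.
  have [_ vl] := andP (vP l); rewrite hit_countE.
  have q0 : 0 <= (q%:R : R) ^+ level (v l) by rewrite exprn_ge0.
  apply: (@le_trans _ _ (2 * (p_ (v l) * q%:R ^+ level (v l)))); last first.
    by rewrite ler_pM2l// weight_level_le.
  rewrite mulrA; apply: ler_wpM2r => //.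
  have m0 := mass_gt0 (v l).
  rewrite word_weight_cat word_weight_nseq -/x.
  have : e1 * p_ w <= x ^+ l * p_ w by rewrite ler_pM2r// e1_le.
  by nra.
have quotE l : (hit_count (v l))%:R / ((hit_count w)%:R * q%:R ^+ (level (v l) - level w)) =
    mass (v l) / mass w :> R.
  rewrite !hit_countE -[X in _ / X]mulrA -exprD subnKC ?level_cat// -mulf_div divff ?mulr1//.
  by rewrite gt_eqF// exprn_gt0.
have mw0 := mass_gt0 w; have mv0 l := mass_gt0 (v l).
have quot_close l : (l <= L)%N -> `|mass (v l) / mass w - x ^+ l| <= e1.
  move=> lL; have [v1 v2] := andP (vP l); have [w1 w2] := andP wP0.
  rewrite ler_distl; apply/andP; split.
    rewrite ler_pdivlMr// -(ler_pM2l M0) (le_trans _ v1)// mulrCA.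
    apply: (@le_trans _ _ ((x ^+ l - e1) * ((1 + e1) * p_ w))).
      by rewrite ler_wpM2l// subr_ge0 e1_le.
    rewrite mulrA ler_pM2r//; have := xl1 l; nra.
  rewrite ler_pdivrMr// -(ler_pM2l M0) (le_trans v2)// mulrCA ler_wpM2l//.
  by rewrite addr_ge0 ?exprn_ge0 ?ltW.
have level_lt l : (l <= L)%N -> (level (v l) - level w < E.+1)%N.
  move=> lL; apply: (@leq_trans (q ^ (level (v l) - level w))).
    exact: ltn_expl.
  apply/ltnW; rewrite ltnS -(ler_nat R) natrX; apply: le_trans (ltW E_gt).
  rewrite ler_pdivlMr//.
  have cK : (hit_count (v l))%:R <= K%:R :> R by rewrite ler_nat -ltnS hit_count_lt.
  have c1 : 1 <= (hit_count w)%:R :> R by rewrite ler1n hit_count_gt0.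
  set Q := q%:R ^+ _; have Q0 : 0 < Q by rewrite exprn_gt0.
  have half : x ^+ L * mass w <= 2 * mass (v l).
    rewrite -(ler_pM2l M0); have [v1 _] := andP (vP l); have [_ w2] := andP wP0.
    have e1_1 : e1 <= 1 by rewrite (le_trans e1x)// xl1.
    have xLl := x_le l lL.
    have : x ^+ L * (M * mass w) <= x ^+ L * (2 * p_ w).
      by rewrite ler_pM2l// (le_trans w2)// ler_pM2r//; lra.
    have : x ^+ L * p_ w <= x ^+ l * p_ w by rewrite ler_pM2r.
    lra.
  have cQ0 : (hit_count w)%:R * Q != 0 by rewrite gt_eqF// mulr_gt0// ltr0n hit_count_gt0.
  have mw_neq0 : mass w != 0 by rewrite gt_eqF.
  have /eqP := quotE l; rewrite -/Q eqr_div// => /eqP qE.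
  rewrite -(ler_pM2r mw0) -mulrA.
  apply: (@le_trans _ _ (Q * (2 * mass (v l)))); first by rewrite ler_pM2l.
  apply: (@le_trans _ _ (2 * (mass (v l) * ((hit_count w)%:R * Q)))).
    have : mass (v l) * Q <= mass (v l) * ((hit_count w)%:R * Q).
      by rewrite ler_pM2l// ler_peMl// ltW.
    lra.
  have : (hit_count (v l))%:R * mass w <= K%:R * mass w by rewrite ler_pM2r.
  by rewrite -qE; lra.
exists [ffun l : 'I_L.+1 => (inord (hit_count (v l)), inord (level (v l) - level w))] => l.
have lL : (l <= L)%N by rewrite -ltnS.
rewrite !ffunE /= !inordK ?hit_count_lt ?level_lt// [v 0%N]cats0 quotE; split.
  exact: hit_count_gt0.
by rewrite (le_trans (quot_close _ lL)).
Qed.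

(** Finitely many tables [t] serve all precisions, so one of them is exact. Two exponents with the
    same numerator give the first relation, and exponent 1 gives the second. *)
Lemma ratio_power_relations (j : 'I_m) : exists a e d N N' : nat,
  [/\ (0 < a)%N, (0 < N)%N, (0 < N')%N,
      p j ^+ a * q%:R ^+ e = q%:R ^+ d & p j * N'%:R = N%:R].
Proof.
(* This makes [K + 2] exponents compete for [K + 1] possible numerators. *)
pose L := (Num.bound (2 * level_bound)).+1.
have [K [E [KE approx]]] := approximate_relations j L.
have [t d e /andP[_ de] td l||t tP] := @finite_limit_exists R _
  (fun (t : {ffun 'I_L.+1 -> 'I_K.+1 * 'I_E.+1}) e => forall l : 'I_L.+1,
    (0 < (t l).1)%N /\
    `|(t l).1%:R / ((t ord0).1%:R * q%:R ^+ (t l).2) - p j ^+ l| <= e).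
- by have [t0 td'] := td l; split=> //; exact: le_trans de.
- exact: approx.
pose N l : nat := (t l).1; pose e l : nat := (t l).2.
have N0 l : (0 < N l)%N by have [] := tP 1 ltr01 l.
have NR0 l : (N l)%:R != 0 :> R by rewrite pnatr_eq0 -lt0n.
have q0 l : (q%:R : R) ^+ l != 0 by rewrite expf_neq0// gt_eqF.
have xE l : (N l)%:R = p j ^+ l * ((N ord0)%:R * q%:R ^+ e l) :> R.
  suff <- : (N l)%:R / ((N ord0)%:R * q%:R ^+ e l) = p j ^+ l :> R.
    by rewrite divfK// mulf_neq0.
  apply/eqP; rewrite -subr_eq0 -normr_le0; apply/ler_addgt0Pr => d d0; rewrite add0r.
  by have [] := tP d d0 l.
have [l1 [l2 [l12 N12]]] : exists l1 l2 : 'I_L.+1, (l1 < l2)%N /\ N l1 = N l2.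
  have : ~~ injectiveb (fun l => (t l).1).
    apply/negP => /injectiveP/leq_card; rewrite !card_ord /L -KE ltnS ltnn//.
  case/injectivePn => l1 [l2]; rewrite -val_eqE/= neq_ltn => /orP[l12|l12] /(congr1 val) N12.
    by exists l1, l2.
  by exists l2, l1.
exists (l2 - l1)%N, (e l2), (e l1), (N (inord 1)), (N ord0 * q ^ e (inord 1))%N.
split=> //; first by rewrite subn_gt0.
- by rewrite muln_gt0 N0 expn_gt0 q_gt0.
- have := xE l2; rewrite -N12 xE -(subnKC (ltnW l12)) exprD addKn -!mulrA.
  have pj0 : p j ^+ l1 != 0 by rewrite expf_neq0// gt_eqF.
  move=> /(mulfI pj0); rewrite mulrCA => /(mulfI (NR0 _)) ->.
  by [].
- by rewrite natrM natrX [RHS]xE inordK// expr1.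
Qed.

End LipschitzImage.

(** * Powers of 1/b *)

(** After the gcd of the exponents is cancelled, Bezout's identity [u * e' = v * a' + 1] gives
    [b = (y ^ u / b ^ v) ^ a']. *)
Lemma common_power_root (a e y b : nat) : (0 < a)%N -> (0 < e)%N -> (1 < b)%N ->
  (y ^ a = b ^ e)%N ->
  exists c a' e' : nat, [/\ (c ^ a' = b)%N, (0 < a')%N, (0 < e')%N & (y ^ a' = b ^ e')%N].
Proof.
move=> a0 e0 b1 yb; have g0 : (0 < gcdn a e)%N by rewrite gcdn_gt0 a0.
have b0 : (0 < b)%N by exact: ltnW.
have aE := divnK (dvdn_gcdl a e); have eE := divnK (dvdn_gcdr a e).
set a' := (a %/ gcdn a e)%N in aE; set e' := (e %/ gcdn a e)%N in eE.
have a'0 : (0 < a')%N by rewrite divn_gt0// dvdn_leq// dvdn_gcdl.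
have e'0 : (0 < e')%N by rewrite divn_gt0// dvdn_leq// dvdn_gcdr.
have yb' : (y ^ a' = b ^ e')%N.
  by apply/eqP; rewrite -(eqn_exp2r _ _ g0) -!expnM aE eE yb.
have [u v uv _] := egcdnP a' e'0.
have coe : gcdn e' a' = 1%N.
  apply/eqP; by rewrite -(eqn_pmul2r g0) mul1n muln_gcdl aE eE gcdnC.
rewrite coe in uv.
have yub : ((y ^ u) ^ a' = (b ^ v) ^ a' * b)%N.
  by rewrite -expnM mulnC expnM yb' -expnM mulnC uv addn1 expnSr -expnM.
have bv_dvd : (b ^ v %| y ^ u)%N by rewrite -(dvdn_pexp2r _ _ a'0) yub dvdn_mulr.
exists (y ^ u %/ b ^ v)%N, a', e'; split=> //.
apply/eqP; rewrite -(@eqn_pmul2l ((b ^ v) ^ a')) ?expn_gt0 ?b0//.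
by rewrite -yub -expnMn mulnC divnK.
Qed.

Section RootIndex.
Variables (R : realType) (q k : nat).
Hypotheses (q_gt1 : (1 < q)%N) (k_max : max_root_index R q k).

Lemma kth_root_exp (l : nat) (x : R) : (0 < l)%N -> 0 <= x -> kth_root l x ^+ l = x.
Proof.
move=> l0 x0; rewrite -powR_mulrn ?powR_ge0// /kth_root -powRrM mulVf ?powRr1//.
by rewrite pnatr_eq0 -lt0n.
Qed.

Lemma max_root_base : exists b : nat,
  (1 < b)%N /\ (b ^ k = q)%N.
Proof.
have [k0 kint _] := k_max.
have /natrP[b bE] : kth_root k (q%:R : R) \is a Num.nat.
  by rewrite natrEint kint powR_ge0.
have bk : (b ^ k = q)%N.
  by apply/eqP; rewrite -(eqr_nat R) natrX -bE kth_root_exp.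
exists b; split=> //; rewrite ltnNge; apply/negP => b1; move: q_gt1.
by rewrite -bk ltnNge -(exp1n k) leq_exp2r// b1.
Qed.

Lemma max_root_le (c l : nat) : (0 < l)%N -> (c ^ l = q)%N -> (l <= k)%N.
Proof.
move=> l0 cl; have [_ _] := k_max; apply=> //.
suff -> : kth_root l (q%:R : R) = c%:R by rewrite rpred_nat.
by rewrite -cl natrX -powR_mulrn// /kth_root -powRrM mulfV ?powRr1// pnatr_eq0 -lt0n.
Qed.

(** The relations force [N] to divide [N'], so [y = 1 / x] is an integer with a power that is a
    power of [b]. Then [b = c ^ a'] by [common_power_root], so [q = c ^ (a' * k)], and maximality of
    [k] leaves [a' = 1]. *)
Lemma power_relation_root (b a e d N N' : nat) (x : R) :
  (1 < b)%N -> (b ^ k = q)%N -> 0 < x < 1 ->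
  (0 < a)%N -> (0 < N)%N -> (0 < N')%N ->
  x ^+ a * q%:R ^+ e = q%:R ^+ d -> x * N'%:R = N%:R ->
  exists2 l, (0 < l)%N & x = b%:R ^- l.
Proof.
move=> b1 bk /andP[x0 x1] a0 N0 N'0 xq xN; have [k0 _ _] := k_max.
have q0 : 0 < q%:R :> R by rewrite ltr0n ltnW.
have de : (d < e)%N.
  rewrite -(@ltr_eXn2l R q%:R) ?ltr1n// -xq.
  by rewrite gtr_pMl ?exprn_gt0// exprn_ilt1 ?ltW// -lt0n.
have xq1 : x ^+ a * q%:R ^+ (e - d) = 1.
  apply: (@mulIf _ (q%:R ^+ d)); first by rewrite expf_neq0// gt_eqF.
  by rewrite -mulrA -exprD subnK ?mul1r// ltnW.
have Nq : (N ^ a * q ^ (e - d) = N' ^ a)%N.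
  apply/eqP; rewrite -(eqr_nat R) natrM !natrX -xN exprMn mulrAC xq1 mul1r //.
have NN' : (N %| N')%N by rewrite -(dvdn_pexp2r _ _ a0) -Nq dvdn_mulr.
pose y := (N' %/ N)%N; have yN : (y * N = N')%N by exact: divnK.
have ya : (y ^ a = b ^ (k * (e - d)))%N.
  apply/eqP; rewrite expnM bk -(@eqn_pmul2l (N ^ a)) ?expn_gt0 ?N0// Nq -yN.
  by rewrite mulnC -expnMn.
have kd0 : (0 < k * (e - d))%N by rewrite muln_gt0 k0 subn_gt0.
have [c [a' [e' [ca a'0 e'0 ye]]]] := common_power_root a0 kd0 b1 ya.
have a'1 : a' = 1%N.
  have : (a' * k <= k)%N by apply: (@max_root_le c); rewrite ?muln_gt0 ?a'0// expnM ca.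
  by case: a' a'0 {ca ye} => [|[|a']]// _; rewrite -{2}(mul1n k) leq_pmul2r.
exists e' => //; rewrite -natrX -ye a'1 expn1.
have y0 : y%:R != 0 :> R.
  by rewrite pnatr_eq0; apply: contraTneq N'0 => y0; rewrite -yN y0 mul0n.
have NR0 : N%:R != 0 :> R by rewrite pnatr_eq0 -lt0n.
apply: (mulIf y0); rewrite mulVf//; apply: (mulIf NR0).
by rewrite -mulrA -natrM yN xN mul1r.
Qed.

End RootIndex.

(** * The dimension of [A] and the equivalences *)

Lemma homogeneous_dim (R : realType) (n q : nat) (r s : R)
    (f : 'I_q -> 'rV[R]_n -> 'rV[R]_n) (A : set 'rV[R]_n) :
  0 < r < 1 -> 0 < s -> q%:R * r `^ s = 1 ->
  self_similar (fun=> r) f A -> SSC f A -> hausdorff_dim A = s%:E.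
Proof.
move=> /andP[r0 r1] s0 qrs A_ss A_ssc.
have sumE t : \sum_(i < q) r `^ t = q%:R * r `^ t by rewrite sumr_const card_ord mulr_natl.
apply/eqP; rewrite eq_le; apply/andP; split; last first.
  by apply: (hausdorff_dim_ge A_ss A_ssc); [exact: ltW | rewrite sumE qrs].
apply/lee_addgt0Pr => e e0; rewrite -EFinD; apply: (hausdorff_dim_le A_ss).
  by rewrite addr_ge0 ?ltW.
rewrite sumE powRD; last by rewrite (gt_eqF r0) implybT.
have one_e : 1 `^ e = 1 :> R by rewrite powR1.
rewrite mulrA qrs mul1r -[ltRHS]one_e.
by apply: gt0_ltr_powR => //; rewrite nnegrE ltW.
Qed.

Theorem theorem7p7 (R : realType) (n1 n2 q k m : nat) (r : R)
  (f : 'I_q -> 'rV[R]_n1 -> 'rV[R]_n1) (A : set 'rV[R]_n1)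
  (rho : 'I_m -> R) (g : 'I_m -> 'rV[R]_n2 -> 'rV[R]_n2) (B : set 'rV[R]_n2)
  (q_gt1 : (1 < q)%N)
  (A_self_similar : self_similar (fun=> r) f A) (A_SSC : SSC f A)
  (k_max : max_root_index R q k)
  (B_self_similar : self_similar rho g B) (B_SSC : SSC g B)
  (dimAB : hausdorff_dim A = hausdorff_dim B) :
  (lipschitz_onto A B <->
     (forall j : 'I_m, exists2 p : nat, (0 < p)%N & rho j = kth_root k r ^+ p))
  /\
  ((forall j : 'I_m, exists2 p : nat, (0 < p)%N & rho j = kth_root k r ^+ p) <->
     bilipschitz_equivalent A B).
Proof.
have q0 : (0 < q)%N by exact: ltnW.
have qR0 : 0 < q%:R :> R by rewrite ltr0n.
have r0 : 0 < r := ratio_gt0 A_self_similar (Ordinal q0).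
have r1 : r < 1 := ratio_lt1 A_self_similar (Ordinal q0).
have lnr : ln r < 0 by rewrite ln_lt0// r0.
have lnq : 0 < ln (q%:R : R) by rewrite ln_gt0// ltr1n.
pose s := - ln (q%:R : R) / ln r.
have s0 : 0 < s by rewrite /s ltr_ndivlMr// mul0r oppr_lt0.
have qrs : q%:R * r `^ s = 1.
  apply: ln_inj; rewrite ?posrE ?mulr_gt0 ?powR_gt0//.
  rewrite lnM ?posrE ?powR_gt0// ln_powR ln1 /s; field.
  by rewrite lt_eqF.
have r01 : 0 < r < 1 by rewrite r0.
have dimB : hausdorff_dim B = s%:E.
  by rewrite -dimAB; exact: homogeneous_dim A_self_similar A_SSC.
have sum_rho := moran_equation B_self_similar B_SSC s0 dimB.
have [k0 _ _] := k_max; have [b [b1 bk]] := max_root_base q_gt1 k_max.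
pose theta := kth_root k r.
have thetak : theta ^+ k = r by rewrite kth_root_exp// ltW.
have theta0 : 0 < theta by rewrite powR_gt0.
have theta1 : theta < 1.
  rewrite ltNge; apply/negP => theta_ge1; move: r1; apply/negP; rewrite -leNgt -thetak.
  exact: exprn_ege1.
have theta01 : 0 < theta < 1 by rewrite theta0.
(* This turns ratios [theta ^+ p] into Moran weights [b ^- p]. *)
have theta_s : theta `^ s = b%:R^-1.
  have rs : r `^ s = b%:R^-1 ^+ k.
    rewrite exprVn -natrX bk; apply: (mulfI (lt0r_neq0 qR0)).
    by rewrite qrs mulfV// gt_eqF.
  rewrite /theta /kth_root powRAC rs -powR_mulrn ?invr_ge0// -powRrM.
  by rewrite mulfV ?powRr1 ?invr_ge0// pnatr_eq0 -lt0n.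
have theta_pow p : (theta ^+ p) `^ s = b%:R ^- p.
  by rewrite -powR_mulrn ?(ltW theta0)// powRAC theta_s powR_mulrn ?invr_ge0// exprVn.
have ratios_bilipschitz : (forall j : 'I_m, exists2 p : nat, (0 < p)%N & rho j = theta ^+ p) ->
    bilipschitz_equivalent A B.
  move=> rho_pow.
  have /choice[p pP] : forall j, exists p : nat, (0 < p)%N /\ rho j = theta ^+ p.
    by move=> j; have [p] := rho_pow j; exists p.
  have b0 : (0 < b)%N by exact: ltnW.
  have [|cB codB] := self_similar_coding B_self_similar B_SSC b0 theta01 pP.
    rewrite -[RHS]sum_rho; apply: eq_bigr => j _.
    by case: (pP j) => _ ->; rewrite theta_pow.
  have [||cA codA] := self_similar_coding A_self_similar A_SSC b0 theta01 (p := fun=> k).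
  - by [].
  - by rewrite sumr_const card_ord -natrX bk -[LHS]mulr_natl mulfV// gt_eqF.
  exact: coding_bilipschitz codA codB.
have lipschitz_ratios : lipschitz_onto A B ->
    forall j : 'I_m, exists2 p : nat, (0 < p)%N & rho j = theta ^+ p.
  move=> [h hAB [C hC]] j.
  have [D D0 AD] := self_similar_bounded A_self_similar.
  have [delta delta0 sep] := SSC_separated B_self_similar B_SSC.
  (* The given Lipschitz constant may be nonpositive, so it is enlarged. *)
  have C'0 : 0 < Num.max C 1 by rewrite lt_max ltr01 orbT.
  have hC' x y : A x -> A y -> edist (h x) (h y) <= Num.max C 1 * edist x y.
    move=> Ax Ay; rewrite (le_trans (hC _ _ Ax Ay))// ler_wpM2r ?edist_ge0//.
    by rewrite le_max lexx.
  have [a [e [d [N [N' [a0 N0 N'0 xq xN]]]]]] := ratio_power_relations q_gt1 A_self_similar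
    AD B_self_similar sep C'0 D0 delta0 hAB hC' s0 qrs sum_rho j.
  have rho0 := ratio_gt0 B_self_similar j.
  have x01 : 0 < rho j `^ s < 1.
    have one_s : 1 `^ s = 1 :> R by rewrite powR1.
    rewrite powR_gt0//= -[ltRHS]one_s; apply: gt0_ltr_powR; rewrite ?nnegrE ?(ltW rho0)//.
    exact: (ratio_lt1 B_self_similar).
  have [p p0 xp] := power_relation_root q_gt1 k_max b1 bk x01 a0 N0 N'0 xq xN.
  exists p => //; apply: (powR_injective s0).
  - by rewrite nnegrE ltW.
  - by rewrite nnegrE exprn_ge0// ltW.
  - by rewrite xp theta_pow.
have bilipschitz_lipschitz : bilipschitz_equivalent A B -> lipschitz_onto A B.
  move=> [h [h' [[hfun _ hsurj] _ hlip _]]]; exists h => //.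
  by apply/seteqP; split=> // _ [x Ax <-]; exact: hfun.
split; split.
- exact: lipschitz_ratios.
- by move=> /ratios_bilipschitz/bilipschitz_lipschitz.
- exact: ratios_bilipschitz.
- by move=> /bilipschitz_lipschitz/lipschitz_ratios.
Qed.
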